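(* Let $f\in\mathbb{F}\langle x_1,\ldots,x_n\rangle$ be a non-commutative polynomial of degree $D$ computed by a $\Sigma\Pi^*\Sigma\Pi^*\Sigma$ circuit of size $s$. Then, provided $|\mathbb{F}|$ is sufficiently large (depending on $D$), $f\not\equiv 0$ if and only if $f$ is not identically zero on the matrix algebra $\mathbb{M}_{s^6}(\mathbb{F})$.
   Context: A non-commutative arithmetic circuit over a field $\mathbb{F}$ in the non-commuting variables $X=\{x_1,\ldots,x_n\}$ is a directed acyclic graph whose in-degree-$0$ nodes are labelled by elements of $X\cup\mathbb{F}$ and whose internal nodes are $+$ gates (unbounded fan-in, with scalar edge labels, computing the corresponding linear combination) or $\times$ gates (fan-in $2$, computing left child times right child); size is the number of gates. Syntactic degree: $1$ for variable leaves, $0$ for constants, max over children at $+$, sum at $\times$. A $+$-regular circuit is a homogeneous circuit whose $+$ gates are partitioned into $+$-layers with no directed path between gates of the same layer, all gates in a layer having the same syntactic degree, the output gate being a $+$ gate, and every input-to-output path passing through a gate of every $+$-layer. A $\Sigma\Pi^*\Sigma\Pi^*\Sigma$ circuit is a $+$-regular circuit with exactly three $+$-layers (bottom and top layers being addition layers), the parts between consecutive $+$-layers consisting only of $\times$ gates of arbitrary depth. ''$f$ is not identically zero on $\mathbb{M}_{N}(\mathbb{F})$'' means there exist $N\times N$ matrices $A_1,\ldots,A_n$ over $\mathbb{F}$ with $f(A_1,\ldots,A_n)\ne 0$. *)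

(* Defs.v *)
From HB Require Import structures.
From mathcomp Require Import all_boot all_order all_algebra.
From mathcomp Require Import finmap.
From mathcomp.multinomials Require Import monalg.

Set Implicit Arguments.
Unset Strict Implicit.
Unset Printing Implicit Defensive.

Import GRing.Theory.
Local Open Scope ring_scope.

(* The free algebra F<x_0, ..., x_(n-1)>: the monoid algebra over F of the    *)
(* free monoid of words in the n letters.                                     *)
Notation ncpoly F n := {malg F[{fmonom 'I_n}]}.

Section NCPoly.
Variables (F : fieldType) (n : nat).
Implicit Types f : ncpoly F n.

Definition ncvar (i : 'I_n) : ncpoly F n := << fmu i >>.

(* mmeasure is 1 + the largest length of a word in the support, and 0 at 0,   *)
(* so the zero polynomial gets degree 0 here.                                 *)
Definition ncdeg f : nat := (mmeasure (@fdeg 'I_n) f).-1.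

(* Satisfied by f = 0 for every d.                                            *)
Definition nchomog (d : nat) f : Prop := forall m, m \in msupp f -> fdeg m = d.

(* 'M[F]_N is only a possibly trivial ring for a variable N, so that mmap,    *)
(* which has a nontrivial ring as its target, does not apply.                 *)
Definition nceval N (A : 'I_n -> 'M[F]_N) f : 'M[F]_N :=
  \sum_(m <- msupp f) f@_m *: \prod_(i <- (m : seq 'I_n)) A i.

End NCPoly.

(* Holds for every b when T is infinite.                                      *)
Definition card_ge (T : eqType) (b : nat) : Prop :=
  exists2 r : seq T, uniq r & (b <= size r)%N.

Inductive gate (F : Type) (n : nat) (V : Type) : Type :=
| Var of 'I_n
| Const of F
| Add of seq (F * V)   (* the edges into a + gate, with their scalar labels *)
| Mul of V & V.        (* left child, right child *)

Arguments Var {F n V}.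
Arguments Const {F n V}.
Arguments Add {F n V}.
Arguments Mul {F n V}.

Definition children (F : Type) (n : nat) (V : Type) (g : gate F n V) : seq V :=
  match g with
  | Var _ | Const _ => [::]
  | Add r => map snd r
  | Mul u v => [:: u; v]
  end.

Definition is_add (F : Type) (n : nat) (V : Type) (g : gate F n V) : bool :=
  if g is Add _ then true else false.

Definition is_leaf (F : Type) (n : nat) (V : Type) (g : gate F n V) : bool :=
  match g with Var _ | Const _ => true | _ => false end.

Record circuit (F : fieldType) (n : nat) := Circuit {
  node : finType;
  label : node -> gate F n node;
  output : node;
  (* the nodes of in-degree 0 are exactly the leaves *)
  label_indeg : forall v, is_leaf (label v) = nilp (children (label v));
  label_acyclic : forall u v, u \in children (label v) ->
    ~~ connect (fun x y => x \in children (label y)) v u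
}.

Section Circuit.
Variables (F : fieldType) (n : nat) (C : circuit F n).
Implicit Types u v : node C.

Definition edge : rel (node C) := fun u v => u \in children (label v).

(* Bottom-up recursion over the circuit. The number k bounds the recursion    *)
(* depth; by acyclicity #|node C| is enough, see cfoldE.                      *)
Section Fold.
Variables (T : Type) (tvar : 'I_n -> T) (tconst : F -> T).
Variables (tadd : seq (F * T) -> T) (tmul : T -> T -> T).

Fixpoint cfold_rec (k : nat) v : T :=
  if k is k'.+1 then
    match label v with
    | Var i => tvar i
    | Const c => tconst c
    | Add r => tadd [seq (e.1, cfold_rec k' e.2) | e <- r]
    | Mul u1 u2 => tmul (cfold_rec k' u1) (cfold_rec k' u2)
    end
  else tconst 0.

Definition cfold v : T := cfold_rec #|node C| v.

Lemma cfold_rec_stable k l v :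
  (#|[pred u | connect edge u v]| <= k)%N ->
  (#|[pred u | connect edge u v]| <= l)%N -> cfold_rec k v = cfold_rec l v.
Proof.
have pos w : (0 < #|[pred u | connect edge u w]|)%N.
  by apply/card_gt0P; exists w; rewrite inE connect0.
elim: k l v => [|k IHk] [|l] v; move=> hk hl.
1,2: by have := leq_trans (pos v) hk.
  by have := leq_trans (pos v) hl.
rewrite /=.
have step u : u \in children (label v) -> cfold_rec k u = cfold_rec l u.
  move=> uv; have lt_uv : (#|[pred w | connect edge w u]| <
                           #|[pred w | connect edge w v]|)%N.
    apply: proper_card; apply/properP; split.
      apply/subsetP => w; rewrite !inE => wu.
      exact: connect_trans wu (connect1 uv).
    by exists v; rewrite !inE ?connect0 //; apply: label_acyclic.
  by apply: IHk; rewrite -ltnS; apply: leq_trans lt_uv _.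
case: (label v) step => [//|//|r|u1 u2] /= step.
  elim: r step => [//|e r IHr] step; congr (tadd _).
  apply/eq_in_map => x xr; rewrite step // map_f //.
  by rewrite !step // !inE eqxx ?orbT.
Qed.

Lemma cfoldE v : cfold v =
  match label v with
  | Var i => tvar i
  | Const c => tconst c
  | Add r => tadd [seq (e.1, cfold e.2) | e <- r]
  | Mul u1 u2 => tmul (cfold u1) (cfold u2)
  end.
Proof.
have -> : cfold v = cfold_rec #|node C|.+1 v.
  by apply: cfold_rec_stable; rewrite ?leqW ?max_card.
by [].
Qed.

End Fold.

Definition node_poly : node C -> ncpoly F n :=
  cfold (@ncvar F n) (fun c => c%:MP)
        (fun r => \sum_(e <- r) e.1 *: e.2) (fun p q => p * q).

Definition circuit_poly : ncpoly F n := node_poly (output C).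

(* Syntactic degree; the scalar labels of the edges play no role in it.       *)
Definition sdeg : node C -> nat :=
  cfold (fun _ => 1%N) (fun _ => 0%N)
        (fun r => \max_(e <- r) e.2)%N (fun d e => d + e)%N.

(* The + and * gates; input nodes are not counted.                            *)
Definition csize : nat := #|[pred v : node C | ~~ is_leaf (label v)]|.

Definition homogeneous : Prop := forall v, nchomog (sdeg v) (node_poly v).

(* The + gates are distributed by lay into k layers, numbered from the bottom *)
(* up; the value of lay on other nodes is irrelevant.                         *)
Definition add_layering (k : nat) (lay : node C -> 'I_k) : Prop :=
  [/\ forall u v, is_add (label u) -> is_add (label v) -> u != v ->
        connect edge u v -> lay u != lay v,
      forall u v, is_add (label u) -> is_add (label v) ->
        connect edge u v -> (lay u <= lay v)%N,
      forall u v, is_add (label u) -> is_add (label v) ->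
        lay u = lay v -> sdeg u = sdeg v
    & forall v p, is_leaf (label v) -> path edge v p -> last v p = output C ->
        forall i : 'I_k,
          exists2 g, g \in v :: p & is_add (label g) && (lay g == i)].

Definition add_regular (k : nat) (lay : node C -> 'I_k) : Prop :=
  [/\ homogeneous, is_add (label (output C)) & add_layering lay].

(* Every + gate belongs to a layer, so that only * gates can occur strictly   *)
(* between consecutive layers. The last condition says that there are no *    *)
(* gates below the bottom layer, whose gates are thus combinations of leaves. *)
Definition SigmaPiSigmaPiSigma : Prop :=
  exists lay : node C -> 'I_3,
    add_regular lay /\
    forall v, is_add (label v) -> lay v = ord0 ->
      all (fun u => is_leaf (label u)) (children (label v)).

End Circuit.

(* Main.v *)
Require Import Defs.
From HB Require Import structures.
From mathcomp Require Import all_boot all_order all_algebra.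
From mathcomp Require Import finmap.
From mathcomp.multinomials Require Import monalg.
From Stdlib Require Import Classical FunctionalExtensionality.

Set Implicit Arguments.
Unset Strict Implicit.
Unset Printing Implicit Defensive.

Import GRing.Theory.
Local Open Scope ring_scope.

(* A sum of k products whose factors lie in a space V of homogeneous          *)
(* polynomials of one degree is reduced by looking at the first factors. If   *)
(* they are proportional, one of them splits off on the left; otherwise some  *)
(* linear form on V kills one of them without killing the sum, so fewer than  *)
(* k products remain. The chain of such steps is evaluated on block           *)
(* triangular matrices, with two blocks per dropped product: one for the      *)
(* common prefix and one for the separated factor. If nonzero elements of V   *)
(* are nonzero on m x m matrices, then by a form of Amitsur's theorem there   *)
(* is one point at which all the factors are invertible, so the prefix does   *)
(* not vanish, and 2km x 2km matrices suffice. Applied to linear forms        *)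
(* (m = 1) and then to the gates of the middle layer (m = 2s), this gives     *)
(* dimension 4s^2 <= s^6.                                                     *)
(* The argument needs infinitely many scalars and takes place over F[X]; the  *)
(* resulting point is specialised to F, where D + 1 elements are enough.      *)

(** If [f] is zero, so are all its values; a nonzero [f] of degree 0 is a scalar. In positive
    degree, regularity of the circuit ([layers_above_prod], [add_gate_combination]) writes [f] as a
    sum of at most s products of middle gates, all of one degree d. A combination of the degree d
    nodes feeding the middle layer is likewise a sum of at most s products of linear forms. So one
    statement, [nonvanishing_sum_prods], is applied twice: if V is a space of homogeneous
    polynomials of one positive degree whose nonzero elements are nonzero on m x m matrices, then a
    nonzero sum of k products of J elements of V is nonzero on 2km x 2km matrices.

    The proof is by induction on J. By [contract_or_factor], either a linear form on the first
    factors keeps the sum nonzero and drops a term, or all first factors are proportional. In the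
    first case [nonvanishing_concatenation] evaluates heads and tails at independent points A and B:
    the value of the tails at B turns the heads into a single nonzero element of V, which A then
    detects. In the second case the common head moves into a prefix Q. To keep Q from vanishing,
    [nonvanishing_det] strengthens a nonzero value to a nonzero determinant, and
    [common_nonvanishing_det] finds one point for all the factors, hence for their products.

    These arguments need a domain in which nonzero polynomials have nonroots. F[X] is one for every
    F, and [constant_point] replaces a point over F[X] by one over F. *)

Section WordSum.
Variables (R : nzRingType) (n : nat) (T : pzRingType).
Variables (phi : {rmorphism R -> T}) (x : 'I_n -> T).
Hypothesis phi_central : forall c t, GRing.comm (phi c) t.
Implicit Types f g : {malg R[{fmonom 'I_n}]}.

(** Stated for any target ring with central coefficients, so that both evaluation at matrices
    ([ncev]) and extension of scalars ([nclift]) are instances. *)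
Definition wsum f : T :=
  \sum_(w <- msupp f) phi f@_w * \prod_(i <- (w : seq 'I_n)) x i.

Lemma wsumEw (d : {fset {fmonom 'I_n}}) f : (msupp f `<=` d)%fset ->
  wsum f = \sum_(w <- d) phi f@_w * \prod_(i <- (w : seq 'I_n)) x i.
Proof.
move=> le; rewrite [LHS](big_fset_incl _ le) => //= w _ /mcoeff_outdom ->.
by rewrite raddf0 mul0r.
Qed.

Lemma wsum_is_zmod_morphism : zmod_morphism wsum.
Proof.
move=> f g; pose d := (msupp f `|` msupp g)%fset.
rewrite !(@wsumEw d) ?fsubsetUl ?fsubsetUr ?msuppB_le // -sumrB.
by apply: eq_bigr => w _; rewrite mcoeffB raddfB mulrBl.
Qed.

HB.instance Definition _ :=
  GRing.isZmodMorphism.Build {malg R[{fmonom 'I_n}]} T wsum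
    wsum_is_zmod_morphism.

Lemma wsumU c w : wsum << c *g w >> = phi c * \prod_(i <- (w : seq 'I_n)) x i.
Proof. by rewrite (wsumEw msuppU_le) big_seq_fset1 mcoeffUU. Qed.

Lemma wsumX i : wsum << fmu i >> = x i.
Proof. by rewrite wsumU rmorph1 mul1r fmU big_seq1. Qed.

Lemma wsumC c : wsum c%:MP = phi c.
Proof. by rewrite wsumU fm1 big_nil mulr1. Qed.

Lemma wsum_is_monoid_morphism : monoid_morphism wsum.
Proof.
split=> [|f g]; first by rewrite wsumC rmorph1.
rewrite malgME raddf_sum mulr_suml /=; apply: eq_bigr => u _.
rewrite raddf_sum mulr_sumr /=; apply: eq_bigr => v _.
rewrite wsumU rmorphM fmM big_cat /= -!mulrA; congr (_ * _).
by rewrite !mulrA phi_central.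
Qed.

Lemma wsumZ c f : wsum (c *: f) = phi c * wsum f.
Proof.
rewrite (wsumEw (msuppZ_le c f)) mulr_sumr.
by apply: eq_bigr => w _; rewrite mcoeffZ rmorphM mulrA.
Qed.

End WordSum.

Lemma eq_wsum (R : nzRingType) n (T : pzRingType)
    (phi psi : {rmorphism R -> T}) (x : 'I_n -> T) :
  phi =1 psi -> wsum phi x =1 wsum psi x.
Proof. by move=> e f; apply: eq_bigr => w _; rewrite e. Qed.

Notation ncpol R n := {malg R[{fmonom 'I_n}]}.

Section Evaluation.
Variables (R : nzRingType) (S : comNzRingType) (iota : {rmorphism R -> S}).
Variables (n N : nat) (A : 'I_n -> 'M[S]_N).

Definition ncev : ncpol R n -> 'M[S]_N := wsum (@scalar_mx S N \o iota) A.

HB.instance Definition _ := GRing.Additive.on ncev.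

Lemma scalar_mx_central (c : R) (B : 'M[S]_N) :
  GRing.comm ((@scalar_mx S N \o iota) c) B.
Proof. exact: comm_scalar_mx. Qed.

HB.instance Definition _ :=
  GRing.isMonoidMorphism.Build (ncpol R n) 'M[S]_N ncev
    (wsum_is_monoid_morphism A scalar_mx_central).

Lemma ncevZ c f : ncev (c *: f) = iota c *: ncev f.
Proof. by rewrite /ncev wsumZ /= -mul_scalar_mx. Qed.

Lemma ncevE f :
  ncev f = \sum_(w <- msupp f) iota f@_w *: \prod_(i <- (w : seq 'I_n)) A i.
Proof. by apply: eq_bigr => w _; rewrite /= -mul_scalar_mx. Qed.

Lemma ncevC c : ncev c%:MP = (iota c)%:M.
Proof. exact: wsumC. Qed.

Lemma ncevX i : ncev << fmu i >> = A i.
Proof. exact: wsumX. Qed.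

End Evaluation.

Lemma eq_ncev (R : nzRingType) (S : comNzRingType)
    (iota iota' : {rmorphism R -> S}) n N (A : 'I_n -> 'M[S]_N) :
  iota =1 iota' -> ncev iota A =1 ncev iota' A.
Proof. by move=> e; apply: eq_wsum => c /=; rewrite e. Qed.

Lemma map_ncev (R : nzRingType) (S S' : comNzRingType)
    (iota : {rmorphism R -> S}) (psi : {rmorphism S -> S'})
    n N (A : 'I_n -> 'M[S]_N) f :
  map_mx psi (ncev iota A f) = ncev (psi \o iota) (fun i => map_mx psi (A i)) f.
Proof.
rewrite !ncevE raddf_sum; apply: eq_bigr => w _ /=.
by rewrite map_mxZ rmorph_prod.
Qed.

Section Lift.
Variables (R : nzRingType) (S : comNzRingType) (iota : {rmorphism R -> S}).
Variables (n : nat).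

Definition nclift : ncpol R n -> ncpol S n :=
  wsum (@mkmalgU {fmonom 'I_n} S mone \o iota) (fun i => << fmu i >>).

HB.instance Definition _ := GRing.Additive.on nclift.

Lemma malgC_central (c : R) (p : ncpol S n) :
  GRing.comm ((@mkmalgU {fmonom 'I_n} S mone \o iota) c) p.
Proof.
rewrite /GRing.comm /= mul_malgC malgM_def fgmulgU malgZ_def.
by apply: eq_bigr => w _; rewrite mulm1 mulrC.
Qed.

HB.instance Definition _ :=
  GRing.isMonoidMorphism.Build (ncpol R n) (ncpol S n) nclift
    (wsum_is_monoid_morphism _ malgC_central).

Lemma ncliftZ c f : nclift (c *: f) = iota c *: nclift f.
Proof. by rewrite /nclift wsumZ /= mul_malgC. Qed.

Lemma prod_fmu (w : seq 'I_n) :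
  \prod_(i <- w) << fmu i >> = << FMonom w >> :> ncpol S n.
Proof.
elim: w => [|i w IH]; first by rewrite big_nil -fmoneE.
rewrite big_cons IH malgM_def fgmulUU mulr1; congr << _ *g _ >>.
by apply/eqP; rewrite fmP fmM fmU.
Qed.

Lemma coef_nclift f w : (nclift f)@_w = iota f@_w.
Proof.
rewrite [in RHS](monalgE f) /nclift /wsum !raddf_sum; apply: eq_bigr => u _.
by rewrite /= prod_fmu mul_malgC mcoeffZ fmK !mcoeffU raddfMn /= mulr_natr.
Qed.

Lemma ncev_lift (S' : comNzRingType) (psi : {rmorphism S -> S'})
    N (A : 'I_n -> 'M[S']_N) f :
  ncev psi A (nclift f) = ncev (psi \o iota) A f.
Proof.
rewrite /nclift {1}/wsum rmorph_sum; apply: eq_bigr => w _ /=.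
rewrite rmorphM /= ncevC; congr (_ * _).
by rewrite rmorph_prod; apply: eq_bigr => i _; rewrite /= ncevX.
Qed.

End Lift.

Section Homogeneous.
Variables (R : nzRingType) (n : nat).
Implicit Types f g : ncpol R n.

Definition homog (d : nat) f : Prop := forall w, w \in msupp f -> fdeg w = d.

Lemma homog0 d : homog d 0.
Proof. by move=> w; rewrite msupp0 inE. Qed.

Lemma homogD d f g : homog d f -> homog d g -> homog d (f + g).
Proof.
move=> hf hg w /(fsubsetP (msuppD_le f g)); rewrite in_fsetU.
by case/orP => [/hf|/hg].
Qed.

Lemma homogZ d c f : homog d f -> homog d (c *: f).
Proof. by move=> hf w /(fsubsetP (msuppZ_le c f)) /hf. Qed.

Lemma homog_sum d (I : Type) (r : seq I) (P : pred I) (f : I -> ncpol R n) :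
  (forall i, P i -> homog d (f i)) -> homog d (\sum_(i <- r | P i) f i).
Proof.
by move=> hf; apply: (big_ind (homog d)) => //; [apply: homog0|apply: homogD].
Qed.

Lemma homogM d e f g : homog d f -> homog e g -> homog (d + e) (f * g).
Proof.
move=> hf hg w /msuppM_le[u [v [uf vg ->]]].
by rewrite fdegM hf // hg.
Qed.

Lemma coef_homog d f w : homog d f -> fdeg w != d -> f@_w = 0.
Proof. by move=> hf; case: msuppP => // /hf ->; rewrite eqxx. Qed.

End Homogeneous.

Lemma homog_lift (R : nzRingType) (S : comNzRingType)
    (iota : {rmorphism R -> S}) n d (f : ncpol R n) :
  homog d f -> homog d (nclift iota f).
Proof.
move=> hf w; rewrite -mcoeff_neq0 coef_nclift => h; apply: hf.
by rewrite -mcoeff_neq0; apply: contraNneq h => ->; rewrite rmorph0.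
Qed.

Definition nonvanishing (R : comNzRingType) n N (f : ncpol R n) : Prop :=
  exists A : 'I_n -> 'M[R]_N, ncev idfun A f != 0.

(** For a domain this amounts to being infinite, in the form in which it is applied. *)
Definition has_nonroots (R : nzRingType) : Prop :=
  forall p : {poly R}, p != 0 -> exists x, p.[x] != 0.

(** * Block triangular evaluation and concatenation *)

Section BlockLinear.
Variables (R : comNzRingType) (a b : nat).

Fact ulsubmx_is_linear : linear (@ulsubmx R a b a b).
Proof. by move=> c M M'; apply/matrixP => i j; rewrite !mxE. Qed.

Fact ursubmx_is_linear : linear (@ursubmx R a b a b).
Proof. by move=> c M M'; apply/matrixP => i j; rewrite !mxE. Qed.

Fact dlsubmx_is_linear : linear (@dlsubmx R a b a b).
Proof. by move=> c M M'; apply/matrixP => i j; rewrite !mxE. Qed.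

Fact drsubmx_is_linear : linear (@drsubmx R a b a b).
Proof. by move=> c M M'; apply/matrixP => i j; rewrite !mxE. Qed.

HB.instance Definition _ := GRing.isLinear.Build R 'M[R]_(a + b) 'M[R]_a
  *:%R (@ulsubmx R a b a b) ulsubmx_is_linear.
HB.instance Definition _ := GRing.isLinear.Build R 'M[R]_(a + b) 'M[R]_(a, b)
  *:%R (@ursubmx R a b a b) ursubmx_is_linear.
HB.instance Definition _ := GRing.isLinear.Build R 'M[R]_(a + b) 'M[R]_(b, a)
  *:%R (@dlsubmx R a b a b) dlsubmx_is_linear.
HB.instance Definition _ := GRing.isLinear.Build R 'M[R]_(a + b) 'M[R]_b
  *:%R (@drsubmx R a b a b) drsubmx_is_linear.

End BlockLinear.

Section BlockTriangular.
Variables (R : nzRingType) (S : comNzRingType) (iota : {rmorphism R -> S}).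
Variables (n a b : nat).
Variables (A : 'I_n -> 'M[S]_a) (U : 'I_n -> 'M[S]_(a, b)) (B : 'I_n -> 'M[S]_b).
Let C i : 'M[S]_(a + b) := block_mx (A i) (U i) 0 (B i).

Lemma prod_triangular (w : seq 'I_n) :
  \prod_(i <- w) C i =
  block_mx (\prod_(i <- w) A i) (ursubmx (\prod_(i <- w) C i))
           0 (\prod_(i <- w) B i).
Proof.
elim: w => [|i w IH].
  by rewrite !big_nil -[in LHS](submxK 1) [1]scalar_mx_block
             block_mxKul block_mxKur block_mxKdl block_mxKdr.
rewrite !big_cons; set P := C i * _.
have -> : P = block_mx (A i * \prod_(j <- w) A j)
   (A i *m ursubmx (\prod_(j <- w) C j) + U i *m \prod_(j <- w) B j)
   0 (B i * \prod_(j <- w) B j).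
  rewrite /P {1}IH [LHS]mulmx_block !mulmx0 !mul0mx !addr0 add0r //.
by rewrite block_mxKur.
Qed.

Lemma ncev_triangular f :
  ncev iota C f = block_mx (ncev iota A f) (ursubmx (ncev iota C f))
                           0 (ncev iota B f).
Proof.
rewrite -[LHS]submxK !ncevE !raddf_sum.
congr block_mx.
- by apply: eq_bigr => w _; rewrite /= linearZ /= prod_triangular block_mxKul.
- by apply: big1 => w _; rewrite /= linearZ /= prod_triangular block_mxKdl scaler0.
- by apply: eq_bigr => w _; rewrite /= linearZ /= prod_triangular block_mxKdr.
Qed.

End BlockTriangular.

Lemma nonvanishing_leq (R : comNzRingType) n N N' (f : ncpol R n) :
  (N <= N')%N -> nonvanishing N f -> nonvanishing N' f.
Proof.
move=> /subnKC <- [A nz]; exists (fun i => block_mx (A i) 0 0 0).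
apply: contraNneq nz => e.
have := ncev_triangular idfun A (fun=> 0) (fun=> 0 : 'M_(N' - N)) f.
by rewrite e => /(congr1 ulsubmx); rewrite block_mxKul => <-; rewrite raddf0.
Qed.

Section Concatenation.
Variables (R : comNzRingType) (n a b : nat).
Variables (A : 'I_n -> 'M[R]_a) (B : 'I_n -> 'M[R]_b) (E : 'M[R]_(a, b)).

(** The upper right block of the product over a word w is the sum of X^|u| A_u E B_v over all
    splittings w = uv with u nonempty: X counts the letters read before the passage from the first
    block to the second. *)
Let A1 i : 'M[{poly R}]_a := 'X *: map_mx polyC (A i).
Let U1 i : 'M[{poly R}]_(a, b) := 'X *: map_mx polyC (A i *m E).
Let B1 i : 'M[{poly R}]_b := map_mx polyC (B i).
Let C i : 'M[{poly R}]_(a + b) := block_mx (A1 i) (U1 i) 0 (B1 i).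
Let coefmx k p q (M : 'M[{poly R}]_(p, q)) := map_mx (fun P : {poly R} => P`_k) M.

Let coefmxD k p q (M N : 'M_(p, q)) : coefmx k (M + N) = coefmx k M + coefmx k N.
Proof. by apply/matrixP => i j; rewrite !mxE coefD. Qed.

Let coefmx_sum k p q I (r : seq I) (M : I -> 'M_(p, q)) :
  coefmx k (\sum_(i <- r) M i) = \sum_(i <- r) coefmx k (M i).
Proof.
elim/big_rec2: _ => [|i x y _ <-]; last by rewrite coefmxD.
by apply/matrixP => i j; rewrite !mxE coef0.
Qed.

Let coefmx_mull k p q r (M : 'M_(p, q)) (N : 'M_(q, r)) :
  coefmx k (map_mx polyC M *m N) = M *m coefmx k N.
Proof.
apply/matrixP => i j; rewrite !mxE coef_sum.
by apply: eq_bigr => l _; rewrite !mxE coefCM.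
Qed.

Let coefmx_mulr k p q r (M : 'M_(p, q)) (N : 'M_(q, r)) :
  coefmx k (M *m map_mx polyC N) = coefmx k M *m N.
Proof.
apply/matrixP => i j; rewrite !mxE coef_sum.
by apply: eq_bigr => l _; rewrite !mxE coefMC.
Qed.

Let coefmxC k p q c (M : 'M_(p, q)) : coefmx k (c%:P *: M) = c *: coefmx k M.
Proof. by apply/matrixP => i j; rewrite !mxE coefCM. Qed.

Let coefmxX k p q (M : 'M_(p, q)) :
  coefmx k ('X *: M) = if k is k'.+1 then coefmx k' M else 0.
Proof. by case: k => [|k]; apply/matrixP => i j; rewrite !mxE coefXM. Qed.

Let coefmxXn k p q (M : 'M_(p, q)) : coefmx k ('X^k *: M) = coefmx 0 M.
Proof. by apply/matrixP => i j; rewrite !mxE coefXnM ltnn subnn. Qed.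

Let map_polyC_prod (N : nat) (M : 'I_n -> 'M[R]_N) (w : seq 'I_n) :
  \prod_(i <- w) map_mx polyC (M i) = map_mx polyC (\prod_(i <- w) M i).
Proof. by rewrite rmorph_prod. Qed.

Let ur_cons i w :
  ursubmx (\prod_(j <- i :: w) C j) =
  'X *: (map_mx polyC (A i) *m ursubmx (\prod_(j <- w) C j)
         + map_mx polyC (A i *m E *m \prod_(j <- w) B j)).
Proof.
rewrite big_cons prod_triangular.
have -> : forall X Y : 'M[{poly R}]_(a + b), X * Y = X *m Y by [].
rewrite mulmx_block block_mxKur block_mxKur /A1 /U1 -!scalemxAl -scalerDr.
by rewrite map_polyC_prod -map_mxM.
Qed.

Let ur0 w : coefmx 0 (ursubmx (\prod_(i <- w) C i)) = 0.
Proof.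
case: w => [|i w]; last by rewrite ur_cons coefmxX.
rewrite big_nil [1]scalar_mx_block block_mxKur.
by apply/matrixP => i j; rewrite !mxE coef0.
Qed.

Let ur_top w : w != [::] ->
  coefmx (size w) (ursubmx (\prod_(i <- w) C i)) = (\prod_(i <- w) A i) *m E.
Proof.
elim: w => // i w IH _; rewrite ur_cons /= coefmxX coefmxD coefmx_mull big_cons.
have mapC k p q (M : 'M[R]_(p, q)) : coefmx k (map_mx polyC M) = M *+ (k == 0)%N.
  by apply/matrixP => r s; rewrite mulmxnE !mxE coefC; case: eqP.
rewrite mapC; case: w IH => [|j w] IH.
  by rewrite ur0 !big_nil mulmx0 add0r mulmx1 mulr1n mulr1.
by rewrite IH // mulr0n addr0 mulmxA.
Qed.

Let coefmx_ur k (f : ncpol R n) :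
  coefmx k (ursubmx (ncev polyC C f)) =
  \sum_(w <- msupp f)
    f@_w *: coefmx k (ursubmx (\prod_(i <- (w : seq 'I_n)) C i)).
Proof.
rewrite ncevE raddf_sum coefmx_sum; apply: eq_bigr => w _.
by rewrite /= linearZ coefmxC.
Qed.

Let coefmx_ur0 f : coefmx 0 (ursubmx (ncev polyC C f)) = 0.
Proof. by rewrite coefmx_ur big1 // => w _; rewrite ur0 scaler0. Qed.

Let coefmx_ur_top d f : (0 < d)%N -> homog d f ->
  coefmx d (ursubmx (ncev polyC C f)) = ncev idfun A f *m E.
Proof.
move=> d0 hf; rewrite coefmx_ur ncevE mulmx_suml big_seq [RHS]big_seq.
apply: eq_bigr => w /hf wd; rewrite -wd -scalemxAl ur_top //.
by rewrite -size_eq0 -lt0n [size _]wd.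
Qed.

Let ul_homog d f : homog d f ->
  ncev polyC A1 f = 'X^d *: map_mx polyC (ncev idfun A f).
Proof.
move=> hf; rewrite map_ncev !ncevE scaler_sumr big_seq [RHS]big_seq.
apply: eq_bigr => w /hf <-; rewrite /= scalerA -commr_polyXn -scalerA.
congr (_ *: _); rewrite /fdeg; elim: (w : seq _) => [|i v IH].
  by rewrite !big_nil scale1r.
rewrite !big_cons IH exprS /A1 -scalerA.
have mE (X Y : 'M[{poly R}]_a) : X * Y = X *m Y by [].
by rewrite !mE -scalemxAl -scalemxAr.
Qed.

Let lr_map f : ncev polyC B1 f = map_mx polyC (ncev idfun B f).
Proof. by rewrite map_ncev; apply: eq_ncev. Qed.

(* In the coefficient of X^d of the upper right block, the part read by the   *)
(* first diagonal block has length exactly d, so it is the left factor.       *)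
Lemma coef_concatenation d (I : eqType) (r : seq I) (f g : I -> ncpol R n) :
  (0 < d)%N -> (forall i, i \in r -> homog d (f i)) ->
  coefmx d (ursubmx (ncev polyC C (\sum_(i <- r) f i * g i))) =
  \sum_(i <- r) ncev idfun A (f i) *m E *m ncev idfun B (g i).
Proof.
move=> d0 hf; rewrite (rmorph_sum (ncev polyC C)) raddf_sum coefmx_sum /=.
rewrite big_seq [RHS]big_seq; apply: eq_bigr => i ri.
rewrite rmorphM /= {1}ncev_triangular [X in _ * X]ncev_triangular.
have -> : forall X Y : 'M[{poly R}]_(a + b), X * Y = X *m Y by [].
rewrite mulmx_block block_mxKur coefmxD (ul_homog (hf i ri)) lr_map.
rewrite -scalemxAl coefmxXn coefmx_mull coefmx_ur0 mulmx0 add0r.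
by rewrite coefmx_mulr (coefmx_ur_top d0 (hf i ri)).
Qed.

End Concatenation.

(** With a matrix unit for E, the entry of f(A) E g(B) is a product of one entry of f(A) and one of
    g(B). The given sum is thus a coefficient of a polynomial entry, and a nonroot of that entry is
    substituted for X. *)
Lemma nonvanishing_concatenation (R : comNzRingType) n a b
    (A : 'I_n -> 'M[R]_a) (B : 'I_n -> 'M[R]_b)
    d (I : eqType) (r : seq I) (f g : I -> ncpol R n) p q u v :
  has_nonroots R -> (0 < d)%N -> (forall i, i \in r -> homog d (f i)) ->
  \sum_(i <- r) ncev idfun A (f i) p q * ncev idfun B (g i) u v != 0 ->
  nonvanishing (a + b) (\sum_(i <- r) f i * g i).
Proof.
move=> infR d0 hf nz.
have := @coef_concatenation _ _ _ _ A B (delta_mx q u) d I r f g d0 hf.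
set C := fun i => block_mx _ _ _ _; move=> /matrixP/(_ p v) e.
have {e nz}: (ursubmx (ncev polyC C (\sum_(i <- r) f i * g i)) p v) != 0.
  apply: contraNneq nz => z; move: e; rewrite mxE z coef0 summxE => e.
  apply/eqP; rewrite [RHS]e; apply: eq_bigr => i _; rewrite -mulmxA mxE (bigD1 q) //= mxE.
  rewrite (bigD1 u) //= !mxE !eqxx mul1r big1 ?addr0; last first.
    by move=> j /negbTE ju; rewrite !mxE ju andbF mul0r.
  rewrite big1 ?addr0 // => j /negbTE jq.
  by rewrite mxE big1 ?mulr0 // => k _; rewrite !mxE jq mul0r.
case/infR => y; rewrite !mxE => nz.
exists (fun i => map_mx (horner_eval y) (C i)).
rewrite (@eq_ncev _ _ idfun (horner_eval y \o polyC)); last first.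
  by move=> c; rewrite /= horner_evalE hornerC.
rewrite -map_ncev; apply: contraNneq nz.
by move/matrixP/(_ (lshift b p) (rshift a v)); rewrite !mxE => h; apply/eqP.
Qed.

(** * Common nonzeros of polynomial functions *)

Section PolynomialOnLines.
Variables (R : idomainType) (n m : nat).
Implicit Types (z : 'I_n -> 'M[R]_m) (g : ('I_n -> 'M[R]_m) -> R).

Definition segment z z' (y : R) : 'I_n -> 'M[R]_m :=
  fun i => z i + y *: (z' i - z i).

(** Restriction to lines is all that is used of polynomial dependence on the entries, so univariate
    polynomials suffice. *)
Definition polynomial_on_lines g : Prop :=
  forall z z', exists P : {poly R}, forall y, P.[y] = g (segment z z' y).

Lemma segment0 z z' : segment z z' 0 = z.
Proof. by apply: functional_extensionality => i; rewrite /segment scale0r addr0. Qed.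

Lemma segment1 z z' : segment z z' 1 = z'.
Proof. by apply: functional_extensionality => i; rewrite /segment scale1r addrC subrK. Qed.

Hypothesis infR : has_nonroots R.

(** On the line joining a nonzero of one function to a nonzero of the product of the others, both
    restrict to nonzero polynomials; a nonroot of their product is a common nonzero. *)
Lemma common_nonzero (I : eqType) (s : seq I) (g : I -> _) :
  (forall i, i \in s -> polynomial_on_lines (g i)) ->
  (forall i, i \in s -> exists z, g i z != 0) ->
  exists z, forall i, i \in s -> g i z != 0.
Proof.
move=> pg nz.
suff [z hz] : exists z, \prod_(i <- s) g i z != 0.
  by exists z => i si; move: hz; rewrite prodf_seq_neq0 => /allP /(_ i si).
suff : polynomial_on_lines (fun z => \prod_(i <- s) g i z) /\
       exists z, \prod_(i <- s) g i z != 0 by case.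
elim: s pg nz => [|i s IH] pg nz.
  split; last by exists (fun=> 0); rewrite big_nil oner_neq0.
  by move=> z z'; exists 1 => y; rewrite big_nil hornerC.
have [||pgs [z2 hz2]] := IH; [by move=> j js; apply: pg; rewrite inE js orbT
                    |by move=> j js; apply: nz; rewrite inE js orbT|].
have pgi : polynomial_on_lines (g i) by apply: pg; rewrite inE eqxx.
have [z1 hz1] : exists z, g i z != 0 by apply: nz; rewrite inE eqxx.
have P z z' : exists P Q : {poly R}, forall y,
    P.[y] = g i (segment z z' y) /\ Q.[y] = \prod_(j <- s) g j (segment z z' y).
  by have [P hP] := pgi z z'; have [Q hQ] := pgs z z'; exists P, Q.
split=> [z z'|].
  have {P}[P [Q hPQ]] := P z z'; exists (P * Q) => y.
  by rewrite hornerM big_cons (hPQ y).1 (hPQ y).2.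
have {P}[P [Q hPQ]] := P z1 z2.
have [y hy] : exists y, (P * Q).[y] != 0.
  apply: infR; rewrite mulf_neq0 //.
    by apply: contraNneq hz1 => P0; rewrite -(segment0 z1 z2) -(hPQ 0).1 P0 horner0.
  by apply: contraNneq hz2 => Q0; rewrite -(segment1 z1 z2) -(hPQ 1).2 Q0 horner0.
by exists (segment z1 z2 y); rewrite big_cons -(hPQ y).1 -(hPQ y).2 -hornerM.
Qed.

Definition generic_segment z z' : 'I_n -> 'M[{poly R}]_m :=
  fun i => map_mx polyC (z i) + 'X *: map_mx polyC (z' i - z i).

Lemma map_generic_segment y z z' i :
  map_mx (horner_eval y) (generic_segment z z' i) = segment z z' y i.
Proof.
by apply/matrixP => p q; rewrite !mxE /= horner_evalE !hornerE.
Qed.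

Lemma polynomial_on_lines_det (f : ncpol R n) :
  polynomial_on_lines (fun z => \det (ncev idfun z f)).
Proof.
move=> z z'; exists (\det (ncev polyC (generic_segment z z') f)) => y.
rewrite -[LHS]/(horner_eval y _) -det_map_mx map_ncev; congr (\det _).
rewrite (@eq_ncev _ _ _ idfun) => [|c]; last by rewrite /= horner_evalE hornerC.
congr (ncev _ _ f); apply: functional_extensionality => i.
exact: map_generic_segment.
Qed.

End PolynomialOnLines.

(** * From a nonzero value to a nonzero determinant *)

Section GenericDeterminant.
Variables (n m : nat).

(* Entry (p, q) gets the weight X^((q - p) mod m.+1), so that a product of    *)
(* these matrices is graded: X^k occurs only in the entries (p, p + k).       *)
Definition cyclic_weight (S : comNzRingType) (M : 'M[S]_m.+1) : 'M[{poly S}]_m.+1 :=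
  \matrix_(p, q) (M p q *: 'X^((q - p)%R : 'I_m.+1)).

(** Conjugation by a cyclic permutation matrix; it preserves the weights, which depend on q - p
    only. *)
Definition cyclic_shift (S : Type) (t : 'I_m.+1) (M : 'M[S]_m.+1) : 'M[S]_m.+1 :=
  \matrix_(p, q) M (p + t) (q + t).

Lemma cyclic_weight_shift (S : comNzRingType) t (M : 'M[S]_m.+1) :
  cyclic_weight (cyclic_shift t M) = cyclic_shift t (cyclic_weight M).
Proof.
by apply/matrixP => p q; rewrite !mxE opprD addrACA subrr addr0.
Qed.

Lemma ncev_shift (R : nzRingType) (S : comNzRingType) (iota : {rmorphism R -> S})
    t (A : 'I_n -> 'M[S]_m.+1) f :
  ncev iota (fun i => cyclic_shift t (A i)) f = cyclic_shift t (ncev iota A f).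
Proof.
have shiftP (w : seq 'I_n) : \prod_(i <- w) cyclic_shift t (A i) =
    cyclic_shift t (\prod_(i <- w) A i).
  elim: w => [|i w IH].
    rewrite !big_nil; apply/matrixP => p q.
    by rewrite !mxE (inj_eq (addIr t)).
  rewrite !big_cons IH; apply/matrixP => p q; rewrite !mxE.
  rewrite [RHS](reindex (fun r => r + t)) /=; last first.
    by exists (fun r => r - t) => r _; rewrite ?addrK ?subrK.
  by apply: eq_bigr => r _; rewrite !mxE.
apply/matrixP => p q; rewrite !ncevE !mxE !summxE; apply: eq_bigr => w _.
by rewrite shiftP !mxE.
Qed.

Section Graded.
Variables (R : nzRingType) (S : comNzRingType) (iota : {rmorphism R -> S}).
Variable z : 'I_n -> 'M[S]_m.+1.
Let W (w : seq 'I_n) := \prod_(i <- w) cyclic_weight (z i).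

Let coef_cons i w p q k :
  (W (i :: w) p q)`_k =
  \sum_r z i p r * (if (k < ((r - p)%R : 'I_m.+1))%N then 0
                    else (W w r q)`_(k - ((r - p)%R : 'I_m.+1))).
Proof.
rewrite /W big_cons mxE coef_sum; apply: eq_bigr => r _.
by rewrite mxE -scalerAl coefZ coefXnM.
Qed.

Let inZpD a b : inZp (a + b) = inZp a + inZp b :> 'I_m.+1.
Proof. by apply: val_inj; rewrite /= modnDm. Qed.

Let coef_graded w p q k : q - p != inZp k -> (W w p q)`_k = 0.
Proof.
elim: w p k => [|i w IH] p k ne.
  rewrite /W big_nil mxE; case: eqP => [e|_]; last by rewrite mulr0n coef0.
  rewrite mulr1n coef1; case: k ne => //; rewrite e subrr => /eqP[].
  by apply: val_inj; rewrite /= mod0n.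
rewrite coef_cons big1 // => r _; case: ltnP => [_|le]; first by rewrite mulr0.
rewrite IH ?mulr0 //; apply: contraNneq ne => e.
rewrite -(subnK le) inZpD valZpK -e addrA addrNK //.
Qed.

Let coef_large w p q k : (size w * m < k)%N -> (W w p q)`_k = 0.
Proof.
elim: w p k => [|i w IH] p k lt.
  rewrite /W big_nil mxE; case: eqP => [e|_]; last by rewrite mulr0n coef0.
  by rewrite mulr1n coef1; case: k lt.
rewrite coef_cons big1 // => r _; case: ltnP => [_|le]; first by rewrite mulr0.
rewrite IH ?mulr0 // ltn_subRL; apply: leq_ltn_trans lt.
by rewrite mulSn leq_add2r leq_ord.
Qed.

Lemma coef_ncev_graded f p q k : q - p != inZp k ->
  (ncev (polyC \o iota) (fun i => cyclic_weight (z i)) f p q)`_k = 0.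
Proof.
move=> ne; rewrite ncevE summxE coef_sum big1 // => w _.
by rewrite mxE coefCM (coef_graded _ ne) mulr0.
Qed.

Lemma coef_ncev_large d f p q k : homog d f -> (d * m < k)%N ->
  (ncev (polyC \o iota) (fun i => cyclic_weight (z i)) f p q)`_k = 0.
Proof.
move=> hf lt; rewrite ncevE summxE coef_sum big_seq big1 // => w /hf wd.
by rewrite mxE coefCM coef_large ?mulr0 // [size _]wd.
Qed.

End Graded.

Lemma map_cyclic_weight (S S' : comNzRingType) (psi : {rmorphism S -> S'})
    (M : 'M[S]_m.+1) :
  map_mx (map_poly psi) (cyclic_weight M) = cyclic_weight (map_mx psi M).
Proof. by apply/matrixP => p q; rewrite !mxE map_polyZ map_polyXn. Qed.

Lemma exists_max (P : nat -> Prop) (b : nat) :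
  (exists k, P k) -> (forall k, P k -> (k <= b)%N) ->
  exists2 k, P k & forall k', P k' -> (k' <= k)%N.
Proof.
move=> [k0 Pk0]; elim: b => [|b IH] le.
  exists k0 => // k' Pk'; exact: leq_trans (le _ Pk') _.
have [Pb|nPb] := classic (P b.+1); first by exists b.+1.
apply: IH => k Pk; have := le _ Pk; rewrite leq_eqVlt => /orP[/eqP e|//].
by case: nPb; rewrite -e.
Qed.

Lemma coefM_top (S : nzRingType) (P Q : {poly S}) a b :
  (forall k, (a < k)%N -> P`_k = 0) -> (forall k, (b < k)%N -> Q`_k = 0) ->
  (P * Q)`_(a + b) = P`_a * Q`_b.
Proof.
move=> hP hQ; have lt : (a < (a + b).+1)%N by rewrite ltnS leq_addr.
rewrite coefM (bigD1 (Ordinal lt)) //= addKn big1 ?addr0 // => -[j ltj] /= ne.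
have {ne}: j != a by apply: contraNneq ne => e; apply/eqP/val_inj.
rewrite neq_ltn => /orP[ja|aj]; last by rewrite hP ?mul0r.
by rewrite hQ ?mulr0 // ltn_subRL ltn_add2r.
Qed.

Variable R : idomainType.
Hypothesis infR : has_nonroots R.

Let G (f : ncpol R n) (z : 'I_n -> 'M[R]_m.+1) : 'M[{poly R}]_m.+1 :=
  ncev (polyC \o idfun) (fun i => cyclic_weight (z i)) f.

Lemma polynomial_on_lines_coef f p q k :
  polynomial_on_lines (fun z => (G f z p q)`_k).
Proof.
move=> z z'.
pose H := ncev (polyC \o polyC) (fun i => cyclic_weight (generic_segment z z' i)) f.
exists (H p q)`_k => y; rewrite -[LHS]/(horner_eval y _) -coef_map.
have -> : G f (segment z z' y) = map_mx (map_poly (horner_eval y)) H.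
  rewrite map_ncev /G (@eq_ncev _ _ _ (map_poly (horner_eval y) \o (polyC \o polyC))).
    congr (ncev _ _ f); apply: functional_extensionality => i.
    by rewrite map_cyclic_weight map_generic_segment.
  by move=> c; rewrite /= map_polyC /= horner_evalE hornerC.
by rewrite mxE.
Qed.

Lemma map_horner_G y f z :
  map_mx (horner_eval y) (G f z) =
  ncev idfun (fun i => map_mx (horner_eval y) (cyclic_weight (z i))) f.
Proof.
by rewrite map_ncev; apply: eq_ncev => c; rewrite /= horner_evalE hornerC.
Qed.

(* A version of Amitsur's theorem that generic matrices generate a domain:    *)
(* the top coefficient of a suitable G z is a monomial matrix.                *)
Lemma nonvanishing_det d (f : ncpol R n) : homog d f -> nonvanishing m.+1 f ->
  exists z : 'I_n -> 'M[R]_m.+1, \det (ncev idfun z f) != 0.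
Proof.
move=> hf [A nzA].
(* The largest exponent k that occurs in any entry at any point; it exists since d * m bounds them
   all. *)
pose P k := exists z p q, (G f z p q)`_k != 0.
have [||k [z0 [p0 [q0 nz0]]] kmax] := @exists_max P (d * m).
- have : exists p q, (ncev idfun A f) p q != 0.
    apply: NNPP => h; move/eqP: nzA; apply; apply/matrixP => p q; rewrite mxE.
    by apply/eqP/negP => /negP ne; apply: h; exists p, q.
  case=> p [q nz]; apply: NNPP => h.
  have G0 : G f A p q = 0.
    apply/polyP => k; rewrite coef0; apply/eqP/negP => /negP ne.
    by apply: h; exists k, A, p, q.
  move/eqP: nz; apply; have := congr1 (horner_eval 1) G0.
  rewrite raddf0 => <-; have /matrixP/(_ p q) := map_horner_G 1 f A.
  rewrite mxE => ->; congr (ncev idfun _ f _ _).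
  apply: functional_extensionality => i; apply/matrixP => r s.
  by rewrite !mxE /= horner_evalE hornerZ hornerXn expr1n mulr1.
- move=> k [z [p [q]]]; apply: contraNT; rewrite -ltnNge => lt.
  by rewrite (coef_ncev_large _ _ _ _ hf lt).
have top z p q j : (k < j)%N -> (G f z p q)`_j = 0.
  move=> lt; apply/eqP/negP => /negP ne; have : P j by exists z, p, q.
  by move/kmax; rewrite leqNgt lt.
have q0E : q0 = p0 + inZp k.
  apply/eqP; rewrite addrC -subr_eq; apply: contraNT nz0 => ne.
  by rewrite /G (coef_ncev_graded _ _ _ ne).
(* Shifting [z0] moves the nonzero coefficient of X^k to any row t, so one point has it nonzero in
   all the entries (t, t + k). *)
have [||z hz] := @common_nonzero R n m.+1 infR _ (enum 'I_m.+1)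
  (fun t z => (G f z t (t + inZp k))`_k).
- by move=> t _; apply: polynomial_on_lines_coef.
- move=> t _; exists (fun i => cyclic_shift (p0 - t) (z0 i)).
  rewrite /G (_ : (fun i => _) =
    fun i => cyclic_shift (p0 - t) (cyclic_weight (z0 i))); last first.
    by apply: functional_extensionality => i; rewrite cyclic_weight_shift.
  by rewrite ncev_shift mxE addrC subrK addrAC [t + _]addrC subrK -q0E.
have nzdet : \det (G f z) != 0.
  apply/det0P => -[v nzv vG].
  (* For a kernel vector [v] with entry of largest degree at [p], column p + k receives X^(deg + k)
     from row [p] only, so nothing cancels it. *)
  pose p := [arg max_(p > ord0) size (v ord0 p)].
  have pmax q : (size (v ord0 q) <= size (v ord0 p))%N.
    by rewrite /p; case: arg_maxnP => // r _; apply.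
  have nzp : v ord0 p != 0.
    apply: contraNneq nzv => e; apply/eqP/rowP => q; rewrite mxE; apply/eqP.
    by rewrite -size_poly_eq0 -leqn0; have := pmax q; rewrite e size_poly0.
  have /rowP/(_ (p + inZp k)) := vG.
  rewrite !mxE => /(congr1 (fun Q : {poly R} => Q`_((size (v ord0 p)).-1 + k))).
  have coefE q : (v ord0 q * G f z q (p + inZp k))`_((size (v ord0 p)).-1 + k) =
      (v ord0 q)`_(size (v ord0 p)).-1 * (G f z q (p + inZp k))`_k.
    apply: coefM_top => [j|j]; last exact: top.
    move=> lt; apply: nth_default; apply: leq_trans (pmax q) _.
    by move: lt; rewrite -ltnS prednK // lt0n size_poly_eq0.
  rewrite coef_sum coef0 (bigD1 p) //= coefE big1 ?addr0.
    move/eqP; rewrite mulf_eq0 (negbTE (hz p _)) ?mem_enum // orbF.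
    by rewrite -/(lead_coef _) lead_coef_eq0 (negbTE nzp).
  move=> q ne; rewrite coefE /G (coef_ncev_graded _ _ _ (k := k)) ?mulr0 //.
  by rewrite addrAC -subr_eq0 addrK subr_eq0 eq_sym.
have [y hy] := infR nzdet.
exists (fun i => map_mx (horner_eval y) (cyclic_weight (z i))).
by rewrite -map_horner_G det_map_mx.
Qed.

End GenericDeterminant.

Lemma common_nonvanishing_det (R : idomainType) n m (s : seq (ncpol R n)) :
  has_nonroots R ->
  (forall f, f \in s -> exists z : 'I_n -> 'M[R]_m, \det (ncev idfun z f) != 0) ->
  exists z : 'I_n -> 'M[R]_m, forall f, f \in s -> \det (ncev idfun z f) != 0.
Proof.
move=> infR hs.
by apply: (common_nonzero infR) => // f _; apply: polynomial_on_lines_det.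
Qed.

(** * Sums of products and their reduction *)

Lemma scale_left_comm (R : comNzRingType) (M : lmodType R) (a b c : R) (g h : M) :
  a *: g = b *: h -> a *: (c *: g) = (c * b) *: h.
Proof. by move=> e; rewrite scalerA mulrC -!scalerA e. Qed.

Lemma scale_cross (R : comNzRingType) (M : lmodType R) (a b c d : R) (g h : M) :
  a *: g = b *: h -> c *: g = d *: h -> (c * b - a * d) *: h = 0.
Proof.
by move=> e e'; rewrite scalerBl -!scalerA -e -e' !scalerA mulrC subrr.
Qed.

Section SumsOfProducts.
Variables (R : idomainType) (n : nat).
Local Notation P := (ncpol R n).
Implicit Types (t : seq (R * seq P)).

Lemma ncpol_scale_eq0 c (f : P) : (c *: f == 0) = (c == 0) || (f == 0).
Proof.
apply/eqP/orP => [e|[/eqP ->|/eqP ->]]; rewrite ?scale0r ?scaler0 //.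
have [c0|c0] := eqVneq c 0; [by left | right].
apply/eqP/malgP => w; have /malgP/(_ w) := e.
by rewrite mcoeffZ !mcoeff0 => /eqP; rewrite mulf_eq0 (negbTE c0) => /eqP.
Qed.

Lemma ncpol_scalerAr c (f g : P) : f * (c *: g) = c *: (f * g).
Proof.
have e h : c%:MP * h = c *: h by exact: mul_malgC.
rewrite -[c *: g]e -[c *: _]e !mulrA; congr (_ * g); apply/esym.
exact: (malgC_central idfun c f).
Qed.

Definition sum_prods t : P := \sum_(x <- t) x.1 *: \prod_(q <- x.2) q.

(** A linear form involving two coordinates: suitable [a] and [b] make it kill a prescribed
    polynomial. *)
Definition bicoef (a : R) u (b : R) v (q : P) : R := a * q@_u - b * q@_v.

Lemma bicoef_sum a u b v (I : Type) (r : seq I) (c : I -> R) (q : I -> P) :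
  bicoef a u b v (\sum_(i <- r) c i *: q i) =
  \sum_(i <- r) c i * bicoef a u b v (q i).
Proof.
rewrite /bicoef !raddf_sum !mulr_sumr -sumrB; apply: eq_bigr => i _.
by rewrite /= !mcoeffZ mulrBr !(mulrCA (c i)).
Qed.

Definition contract (phi : P -> R) t : seq (R * seq P) :=
  [seq (x.1 * phi (head 0 x.2), behead x.2) | x <- t & phi (head 0 x.2) != 0].

Lemma sum_prods_contract phi t :
  sum_prods (contract phi t) =
  \sum_(x <- t) (x.1 * phi (head 0 x.2)) *: \prod_(q <- behead x.2) q.
Proof.
rewrite /sum_prods big_map big_filter /= big_mkcond; apply: eq_bigr => x _.
by case: eqP => //= ->; rewrite mulr0 scale0r.
Qed.

Lemma size_contract phi t x :
  x \in t -> phi (head 0 x.2) = 0 -> (size (contract phi t) < size t)%N.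
Proof.
move=> xt e; rewrite size_map size_filter ltn_neqAle count_size andbT -all_count.
by apply/allPn; exists x; rewrite // e eqxx.
Qed.

Lemma sum_prods_cons t : (forall x, x \in t -> x.2 != [::]) ->
  sum_prods t =
  \sum_(x <- t) (x.1 *: head 0 x.2) * \prod_(q <- behead x.2) q.
Proof.
move=> ht; rewrite /sum_prods big_seq [RHS]big_seq; apply: eq_bigr => x /ht.
by case: x => c [|q l] //= _; rewrite big_cons scalerAl.
Qed.

(** Expanding the heads into words, the sum equals the sum over w of w times its contraction by the
    coordinate form at w; these contractions cannot all vanish. *)
Lemma exists_coef_contract t : (forall x, x \in t -> x.2 != [::]) ->
  sum_prods t != 0 ->
  exists w, \sum_(x <- t)
    (x.1 * (head 0 x.2)@_w) *: \prod_(q <- behead x.2) q != 0.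
Proof.
move=> ht nz; apply: NNPP => h; move/eqP: nz; apply; rewrite sum_prods_cons //.
pose d := (\bigcup_(x <- t) msupp (head 0 x.2))%fset.
transitivity (\sum_(w <- d) << w >> * \sum_(x <- t)
    (x.1 * (head 0 x.2)@_w) *: \prod_(q <- behead x.2) q).
  under [RHS]eq_bigr => w _ do rewrite mulr_sumr.
  rewrite exchange_big /= big_seq [RHS]big_seq; apply: eq_bigr => x xt.
  rewrite {1}(@monalgEw _ _ (head 0 x.2) d); last first.
    exact: (@bigfcup_sup _ _ t x xpredT _ xt isT).
  rewrite scaler_sumr mulr_suml; apply: eq_bigr => w _.
  have e : x.1 *: << (head 0 x.2)@_w *g w >> =
           (x.1 * (head 0 x.2)@_w) *: << w >> :> P.
    apply/malgP => u; rewrite [LHS]mcoeffZ [RHS]mcoeffZ [in LHS]mcoeffU.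
    by rewrite [in RHS]mcoeffU !mulrnAr mulr1.
  by rewrite e [RHS]ncpol_scalerAr [RHS]scalerAl.
apply: big1 => w _; rewrite [X in _ * X](_ : _ = 0) ?mulr0 //.
by apply/eqP/negP => /negP ne; apply: h; exists w.
Qed.

(* Two coordinates in which the heads are not proportional give two linear    *)
(* forms that kill one head each and span the coordinate form at w.           *)
Lemma contract_or_factor t : (forall x, x \in t -> x.2 != [::]) ->
  sum_prods t != 0 ->
  (exists a u b v, sum_prods (contract (bicoef a u b v) t) != 0 /\
     (size (contract (bicoef a u b v) t) < size t)%N) \/
  (exists a (c : R * seq P -> R) x1, [/\ a != 0, x1 \in t &
     a *: sum_prods t = head 0 x1.2 *
       sum_prods [seq (x.1 * c x, behead x.2) | x <- t]]).
Proof.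
move=> ht nz; have [w hw] := exists_coef_contract ht nz.
set g := fun w => \sum_(x <- t) (x.1 * (head 0 x.2)@_w) *: \prod_(q <- behead x.2) q.
have {}hw : g w != 0 by exact: hw.
have contractE a u b v :
    sum_prods (contract (bicoef a u b v) t) = a *: g u - b *: g v.
  rewrite sum_prods_contract !scaler_sumr -sumrB; apply: eq_bigr => x _.
  by rewrite !scalerA -scalerBl /bicoef mulrBr !(mulrCA x.1).
have [/hasP[x xt /eqP x0]|/hasPn nz0] := boolP (has (fun x => (head 0 x.2)@_w == 0) t).
  left; exists 1, w, 0, w; split.
    by rewrite contractE scale1r scale0r subr0.
  by apply: (size_contract xt); rewrite /bicoef x0 mulr0 mul0r subr0.
have [x1 x1t] : exists x1, x1 \in t.
  case: t nz {ht hw g contractE nz0} => [|x1 t] nz; last by exists x1; rewrite inE eqxx.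
  by move: nz; rewrite /sum_prods big_nil eqxx.
have [[x [w' [xt ne]]]|prop] := classic (exists x w', x \in t /\
    (head 0 x1.2)@_w * (head 0 x.2)@_w' <> (head 0 x.2)@_w * (head 0 x1.2)@_w').
  left; have kill y : y \in t ->
      (size (contract (bicoef (head 0%R y.2)@_w w' (head 0%R y.2)@_w' w) t) < size t)%N.
    by move=> yt; apply: (size_contract yt); rewrite /bicoef mulrC subrr.
  have [e|nzx] := eqVneq (sum_prods (contract
      (bicoef (head 0 x.2)@_w w' (head 0 x.2)@_w' w) t)) 0; last first.
    by do 4!eexists; split; [exact: nzx | exact: kill].
  have [e1|nzx] := eqVneq (sum_prods (contract
      (bicoef (head 0 x1.2)@_w w' (head 0 x1.2)@_w' w) t)) 0; last first.
    by do 4!eexists; split; [exact: nzx | exact: kill].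
  move: e e1; rewrite !contractE => /eqP; rewrite subr_eq0 => /eqP e /eqP.
  rewrite subr_eq0 => /eqP e1.
  (* If both contractions vanish, they are two independent linear relations between [g w'] and
     [g w], which forces [g w] to be zero. *)
  have /eqP := scale_cross e e1.
  rewrite ncpol_scale_eq0 => /orP[|g0]; last by case/negP: hw.
  by rewrite subr_eq0 => /eqP e2; case: ne.
right; exists (head 0 x1.2)@_w, (fun x => (head 0 x.2)@_w), x1; split=> //.
  exact: nz0.
rewrite (sum_prods_cons ht) /sum_prods big_map scaler_sumr mulr_sumr.
rewrite big_seq [RHS]big_seq; apply: eq_bigr => x xt /=.
have e : (head 0 x1.2)@_w *: head 0 x.2 = (head 0 x.2)@_w *: head 0 x1.2.
  apply/malgP => w'; rewrite [LHS]mcoeffZ [RHS]mcoeffZ; apply: NNPP => ne.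
  by apply: prop; exists x, w'.
have {}e := scale_left_comm x.1 e.
by rewrite [LHS]scalerAl e [RHS]ncpol_scalerAr [RHS]scalerAl.
Qed.

End SumsOfProducts.

(** * Matrix dimension for sums of products *)

Section NonvanishingSums.
Variables (R : idomainType) (n m d : nat).
Hypothesis infR : has_nonroots R.
Variable V : ncpol R n -> Prop.
Hypothesis V0 : V 0.
Hypothesis VD : forall f g, V f -> V g -> V (f + g).
Hypothesis VZ : forall c f, V f -> V (c *: f).
Hypothesis Vhomog : forall f, V f -> homog d f.
Hypothesis d_gt0 : (0 < d)%N.
Hypothesis Vnonvanishing : forall f, V f -> f != 0 -> nonvanishing m.+1 f.
Implicit Types (t : seq (R * seq (ncpol R n))).

Let Vsum (I : eqType) (r : seq I) (f : I -> ncpol R n) :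
  (forall i, i \in r -> V (f i)) -> V (\sum_(i <- r) f i).
Proof. by move=> hf; rewrite big_seq; apply: (big_ind V). Qed.

Let nonvanishing_mul e N (f g : ncpol R n) : (0 < e)%N -> homog e f ->
  nonvanishing m.+1 f -> nonvanishing N g -> nonvanishing (m.+1 + N) (f * g).
Proof.
move=> e0 hf [A nzA] [B nzB].
have entry k (M : 'M[R]_k) : M != 0 -> exists p q, M p q != 0.
  move=> nz; apply: NNPP => h; move/eqP: nz; apply; apply/matrixP => p q.
  by rewrite mxE; apply/eqP/negP => /negP ne; apply: h; exists p, q.
have [p [q nzpq]] := entry _ _ nzA; have [u [v nzuv]] := entry _ _ nzB.
rewrite -[f * g](big_seq1 +%R tt (fun=> f * g)).
apply: (@nonvanishing_concatenation R n _ _ A B e unit _ (fun=> f) (fun=> g) p q u v) => //.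
by rewrite big_seq1 mulf_neq0.
Qed.

(** Fix [B] and a nonzero entry (r, s) of the contracted sum. Replacing each tail by its entry there
    yields a combination [q] of the heads on which the linear form is nonzero. So [q] is a nonzero
    element of [V], nonzero at some [A], and concatenation joins [A] and [B]. *)
Let nonvanishing_sum_step t a u b v N : (forall x, x \in t ->
    x.2 != [::] /\ forall q, q \in x.2 -> V q) ->
  nonvanishing N (sum_prods (contract (bicoef a u b v) t)) ->
  nonvanishing (m.+1 + N) (sum_prods t).
Proof.
move=> ht [B]; rewrite sum_prods_contract => nzB.
have [r [s nz]] : exists r s, \sum_(x <- t) x.1 * bicoef a u b v (head 0 x.2) *
    (ncev idfun B (\prod_(q <- behead x.2) q)) r s != 0.
  apply: NNPP => h; move/eqP: nzB; apply; apply/matrixP => r s; rewrite mxE.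
  apply/eqP/negP => /negP ne; apply: h; exists r, s; apply: contraNneq ne => <-.
  rewrite raddf_sum /= summxE; apply/eqP; apply: eq_bigr => x _.
  by rewrite ncevZ mxE.
pose c x := x.1 * (ncev idfun B (\prod_(q <- behead x.2) q)) r s.
pose q := \sum_(x <- t) c x *: head 0 x.2.
have headV x : x \in t -> V (head 0 x.2).
  by case: x => a' [|q' l] // /ht [_ h]; apply: h; rewrite inE eqxx.
have Vq : V q by apply: Vsum => x xt; apply: VZ; apply: headV.
have nzq : q != 0.
  apply: contraNneq nz => q0; have := bicoef_sum a u b v t c (fun x => head 0 x.2).
  rewrite -/q q0 /bicoef !mcoeff0 !mulr0 subrr => e; rewrite [X in _ == X]e.
  by apply/eqP/eq_bigr => x _; rewrite /c mulrAC.
have [A /eqP nzA] := Vnonvanishing Vq nzq.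
rewrite sum_prods_cons => [|x /ht[]//].
apply: NNPP => h; apply: nzA; apply/matrixP => i j; rewrite mxE.
apply/eqP/negP => /negP ne; apply: h.
apply: (@nonvanishing_concatenation R n _ _ A B d _ _ _ _ i j r s) => //.
  by move=> x /headV h; apply: homogZ; apply: Vhomog.
apply: contraNneq ne => <-; rewrite raddf_sum /= summxE; apply/eqP.
by apply: eq_bigr => x _; rewrite !ncevZ !mxE /c mulrAC.
Qed.

Section FixedPoint.
Variable Z : 'I_n -> 'M[R]_m.+1.

(** [Q] collects the heads split off so far. It is either 1 or of positive degree, because
    concatenation asks for a left factor of positive degree. *)
Lemma nonvanishing_prefix J t e Q :
  (forall x, x \in t -> size x.2 = J /\
     forall q, q \in x.2 -> V q /\ (q != 0 -> \det (ncev idfun Z q) != 0)) ->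
  Q = 1 \/ (0 < e)%N /\ homog e Q ->
  \det (ncev idfun Z Q) != 0 ->
  sum_prods t != 0 -> nonvanishing (2 * size t * m.+1) (Q * sum_prods t).
Proof.
have detN0 (M : 'M[R]_m.+1) : \det M != 0 -> M != 0.
  by apply: contraNneq => ->; rewrite det0.
elim: J t e Q => [|J IH] t e Q ht hQ detQ nz.
  have t_gt0 : (0 < size t)%N.
    by case: t nz {ht} => //; rewrite /sum_prods big_nil eqxx.
  apply: (@nonvanishing_leq _ _ m.+1).
    by rewrite leq_pmull // muln_gt0.
  have tE : sum_prods t = (\sum_(x <- t) x.1) *: 1.
    rewrite scaler_suml /sum_prods big_seq [RHS]big_seq; apply: eq_bigr => x /ht.
    by case: x => c l /= [/size0nil -> _]; rewrite big_nil.
  exists Z; move: nz; rewrite tE => nz.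
  have c0 : \sum_(x <- t) x.1 != 0 by apply: contraNneq nz => ->; rewrite scale0r.
  have -> : ncev idfun Z (Q * ((\sum_(x <- t) x.1) *: 1)) =
      (\sum_(x <- t) x.1) *: ncev idfun Z Q.
    by rewrite rmorphM /= ncevZ rmorph1 -[_ * _]/(_ *m _) -scalemxAr mulmx1.
  by apply: detN0; rewrite detZ mulf_neq0 // expf_neq0.
have ht0 x : x \in t -> x.2 != [::].
  by move=> /ht [sz _]; apply: contraTneq isT => e0; move: sz; rewrite e0.
case: (contract_or_factor ht0 nz) => [[a [u [b [v [nz' lt]]]]]|[a [c [x1 [a0 x1t eq]]]]].
  (* The induction restarts with an empty prefix. One block then goes to the contracted head and one
     to [Q], paid for by the dropped term. *)
  have := IH (contract (bicoef a u b v) t) 0%N 1 _ (or_introl erefl).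
  have ht' x : x \in contract (bicoef a u b v) t -> size x.2 = J /\
     forall q, q \in x.2 -> V q /\ (q != 0 -> \det (ncev idfun Z q) != 0).
    move=> /mapP[y]; rewrite mem_filter => /andP[_ /ht [sz hy]] -> /=.
    by rewrite size_behead sz; split => // q /mem_behead /hy.
  rewrite rmorph1 det1 oner_neq0 mul1r => /(_ ht' isT nz') nv.
  have {}nv : nonvanishing (m.+1 + 2 * size (contract (bicoef a u b v) t) * m.+1)
                (sum_prods t).
    apply: (nonvanishing_sum_step _ nv) => x xt; split; first exact: ht0.
    by move=> q /(proj2 (ht x xt)) [].
  apply: (@nonvanishing_leq _ _ (m.+1 + (m.+1 +
      2 * size (contract (bicoef a u b v) t) * m.+1))).
    rewrite addnA addnn -mul2n -!mulnA -mulnDr leq_mul2l /= -mulSn.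
    by rewrite leq_mul2r lt orbT.
  case: hQ => [->|[e0 hQ]].
    by rewrite mul1r; apply: nonvanishing_leq nv; apply: leq_addl.
  by apply: nonvanishing_mul e0 hQ _ nv; exists Z; apply: detN0.
set t' := map _ _ in eq.
have nzt' : head 0 x1.2 * sum_prods t' != 0.
  by rewrite -eq ncpol_scale_eq0 (negbTE a0) (negbTE nz).
have [V1 det1] : V (head 0 x1.2) /\
    (head 0 x1.2 != 0 -> \det (ncev idfun Z (head 0 x1.2)) != 0).
  have := ht0 _ x1t; have [_] := ht _ x1t.
  by case: x1.2 => // q l h _; apply: h; rewrite inE eqxx.
have {}det1 : \det (ncev idfun Z (head 0 x1.2)) != 0.
  by apply: det1; apply: contraNneq nzt' => ->; rewrite mul0r.
have size_t' : size t' = size t by rewrite size_map.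
have : nonvanishing (2 * size t' * m.+1) (Q * head 0 x1.2 * sum_prods t').
  (* For [Q] = 1 the number [e] carries no information, so the new prefix has degree [d]. *)
  apply: (IH _ (if Q == 1 then d else (e + d)%N)).
  - move=> x /mapP[y /ht [sz hy]] -> /=.
    by rewrite size_behead sz; split => // q /mem_behead /hy.
  - right; case: eqP => [->|Q1]; first by rewrite mul1r; split => //; apply: Vhomog.
    case: hQ => // -[e0 hQ]; rewrite addn_gt0 e0; split => //.
    by apply: homogM => //; apply: Vhomog.
  - by rewrite rmorphM /= det_mulmx mulf_neq0.
  - by apply: contraNneq nzt' => ->; rewrite mulr0.
rewrite size_t' => -[A]; rewrite -mulrA -eq => nzA; exists A.
apply: contraNneq nzA => z.
by rewrite ncpol_scalerAr ncevZ z scaler0.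
Qed.

End FixedPoint.

Lemma nonvanishing_sum_prods J t :
  (forall x, x \in t -> size x.2 = J /\ forall q, q \in x.2 -> V q) ->
  sum_prods t != 0 -> nonvanishing (2 * size t * m.+1) (sum_prods t).
Proof.
(* The nonzero factors are finitely many, so a single point gives all of them nonzero
   determinants. *)
move=> ht nz; pose s := [seq q <- flatten [seq x.2 | x <- t] | q != 0].
have memV x q : x \in t -> q \in x.2 -> V q by move=> /ht [_]; apply.
have [|Z hZ] := @common_nonvanishing_det R n m.+1 s infR.
  move=> q; rewrite mem_filter => /andP[q0 /flattenP[l /mapP[x xt ->] qx]].
  have Vq := memV _ _ xt qx.
  exact: (nonvanishing_det infR (Vhomog Vq) (Vnonvanishing Vq q0)).
rewrite -[sum_prods t]mul1r.
apply: (@nonvanishing_prefix Z J t 0%N 1) => //; last first.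
- by rewrite rmorph1 det1 oner_neq0.
- by left.
move=> x xt; split; first by have [] := ht _ xt.
move=> q qx; split; first exact: memV xt qx.
move=> q0; apply: hZ; rewrite mem_filter q0; apply/flattenP; exists x.2 => //.
exact: map_f.
Qed.

End NonvanishingSums.

(** * Linear forms, and descent from F[X] to F *)

Lemma nonvanishing_linear_form (R : comNzRingType) n (f : ncpol R n) :
  homog 1 f -> f != 0 -> nonvanishing 1 f.
Proof.
move=> hf nz.
have [w wf] : exists w, w \in msupp f.
  apply: NNPP => h; move/eqP: nz; apply; apply/malgP => w; rewrite mcoeff0.
  by apply: mcoeff_outdom; apply/negP => wf; apply: h; exists w.
have : size (w : seq _) = 1%N := hf w wf.
case: w wf => -[|i [|]] //= wf _.
exists (fun j => (j == i)%:R%:M); apply/eqP => /matrixP/(_ ord0 ord0).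
rewrite ncevE summxE mxE (big_fsetD1 _ wf) /= [X in _ + X]big_seq_cond [X in _ + X]big1 => [|u].
  rewrite addr0 mxE big_seq1 mxE !eqxx mulr1 => /eqP.
  by rewrite mcoeff_eq0 wf.
rewrite andbT in_fsetD1 => /andP[ne /hf]; rewrite /fdeg.
case: u ne => -[|j [|]] //= ne _; rewrite mxE big_seq1 mxE.
have -> : (j == i) = false by apply: contraNF ne => /eqP ->.
by rewrite mul0rn mulr0.
Qed.

(** The powers of X are distinct, and more of them are available than the polynomial can have
    roots. *)
Lemma has_nonroots_poly (F : fieldType) : has_nonroots {poly F}.
Proof.
move=> p nz; pose s : seq {poly F} := [seq 'X^i | i <- iota 0 (size p)].
have us : uniq s.
  rewrite map_inj_uniq ?iota_uniq // => i j e.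
  by have := congr1 (fun q : {poly F} => size q) e; rewrite !size_polyXn => -[].
have [rs|/allPn[x _ nrx]] := boolP (all (root p) s); last by exists x.
by have := max_poly_roots nz rs us; rewrite size_map size_iota ltnn.
Qed.

Section PolynomialPoints.
Variables (n N D : nat).

Lemma coef_ncev_pencil (R : nzRingType) (S : comNzRingType)
    (iota : {rmorphism R -> S}) (U V : 'I_n -> 'M[S]_N) (f : ncpol R n) p q j :
  homog D f -> (D < j)%N ->
  (ncev (polyC \o iota)
     (fun i => map_mx polyC (U i) + 'X *: map_mx polyC (V i)) f p q)`_j = 0.
Proof.
set A := fun i => _; move=> hf lt.
have word (w : seq 'I_n) k r s : (size w < k)%N -> ((\prod_(i <- w) A i) r s)`_k = 0.
  elim: w k r s => [|i w IH] k r s.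
    by rewrite big_nil mxE -polyC_natr coefC; case: k.
  case: k => // k lt'; rewrite big_cons mxE coef_sum big1 // => l _.
  rewrite /A !mxE mulrDl coefD -mulrA coefXM !coefCM !IH ?mulr0 ?addr0 //.
  exact: ltnW.
rewrite ncevE summxE coef_sum big_seq big1 // => w /hf wD.
by rewrite mxE coefCM word ?mulr0 // [size _]wD.
Qed.

(* A point A_0 + X A_1 + ... + X^k A_k is specialised one degree at a time:   *)
(* in A_0 + Y (A_1 + X A_2 + ...) the new variable Y has degree at most D.    *)
Lemma constant_point (F : fieldType) (s : seq F) (f : ncpol F n)
    (A : 'I_n -> 'M[{poly F}]_N) :
  uniq s -> (D < size s)%N -> homog D f -> ncev polyC A f != 0 ->
  exists B : 'I_n -> 'M[F]_N, ncev idfun B f != 0.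
Proof.
move=> us Ds hf.
have [k] : exists k, forall i p q, (size (A i p q) <= k.+1)%N.
  exists (\max_i \max_p \max_q size (A i p q)) => i p q; apply: leqW.
  apply: leq_trans (leq_bigmax i); apply: leq_trans (leq_bigmax p).
  exact: (leq_bigmax (F := fun q => size (A i p q)) q).
elim: k A => [|k IH] A szA nz.
  exists (fun i => map_mx (horner_eval 0) (A i)).
  apply: contraNneq nz => e; apply/eqP.
  transitivity (map_mx polyC (ncev idfun
    (fun i => map_mx (horner_eval 0) (A i)) f)); last by rewrite e map_mx0.
  rewrite map_ncev; congr (ncev _ _ f).
  apply: functional_extensionality => i; apply/matrixP => p q; rewrite !mxE /=.
  by rewrite horner_evalE {1}(size1_polyC (szA i p q)) [in RHS](size1_polyC (szA i p q)) hornerC.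
pose B0 i : 'M[F]_N := \matrix_(p, q) (A i p q)`_0.
pose B1 i : 'M[{poly F}]_N := \matrix_(p, q) \poly_(j < k.+1) (A i p q)`_j.+1.
(* The outer variable is Y. Setting Y = X gives back [A]; setting Y to a scalar lowers the degree in
   X of the point by one. *)
pose H := ncev (polyC \o polyC)
  (fun i => map_mx polyC (map_mx polyC (B0 i)) + 'X *: map_mx polyC (B1 i)) f.
have HE (y : {poly F}) : map_mx (horner_eval y) H =
    ncev polyC (fun i => map_mx polyC (B0 i) + y *: B1 i) f.
  rewrite map_ncev (@eq_ncev _ _ _ polyC); last first.
    by move=> c; rewrite /= horner_evalE hornerC.
  congr (ncev _ _ f); apply: functional_extensionality => i.
  by apply/matrixP => p q; rewrite !mxE /= horner_evalE !hornerE.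
have AE : A = fun i => map_mx polyC (B0 i) + 'X *: B1 i.
  apply: functional_extensionality => i; apply/matrixP => p q; rewrite !mxE.
  apply/polyP => -[|j]; rewrite coefD coefC coefXM /= ?addr0 // add0r coef_poly.
  by case: ltnP => // le; rewrite nth_default // (leq_trans (szA i p q)).
have [p [q nzH]] : exists p q, H p q != 0.
  apply: NNPP => h; move/eqP: nz; apply; rewrite AE -HE.
  apply/matrixP => p q; rewrite !mxE; apply/eqP/negP => /negP ne; apply: h.
  by exists p, q; apply: contraNneq ne => ->; rewrite raddf0.
(* The entry has degree at most [D] in Y, so it cannot vanish at all of the more than [D] scalars of
   [s]. *)
have [y ys nzy] : exists2 y, y \in s & (H p q).[y%:P] != 0.
  have [rs|/allPn[y' /mapP[y ys ->] nr]] := boolP (all (root (H p q)) (map polyC s)).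
    have := max_poly_roots nzH rs; rewrite map_inj_uniq; last exact: polyC_inj.
    rewrite us size_map => /(_ isT) lt.
    suff : (size (H p q) <= D.+1)%N by rewrite leqNgt (leq_ltn_trans Ds lt).
    by apply/leq_sizeP => j; apply: coef_ncev_pencil.
  by exists y.
apply: (IH (fun i => map_mx polyC (B0 i) + y%:P *: B1 i)).
  move=> i r c; rewrite !mxE (leq_trans (size_polyD _ _)) // geq_max.
  rewrite (leq_trans (size_polyC_leq1 _)) //= mul_polyC.
  by rewrite (leq_trans (size_scale_leq _ _)) // size_poly.
rewrite -HE; apply: contraNneq nzy => /matrixP/(_ p q); rewrite !mxE => h.
by apply/eqP; exact: h.
Qed.

End PolynomialPoints.

Lemma ncevE_nceval (F : fieldType) n N (A : 'I_n -> 'M[F]_N) (f : ncpol F n) :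
  ncev idfun A f = nceval A f.
Proof. exact: ncevE. Qed.

Lemma nceval_lift_neq0 (F : fieldType) n N D (s : seq F) (f : ncpol F n) :
  uniq s -> (D < size s)%N -> homog D f ->
  nonvanishing N (nclift polyC f) ->
  exists A : 'I_n -> 'M[F]_N, nceval A f != 0.
Proof.
move=> us Ds hf [A]; rewrite ncev_lift => nz.
have [|B nzB] := @constant_point n N D F s f A us Ds hf.
  by move: nz; congr (is_true (_ != 0)); apply: eq_ncev.
by exists B; rewrite -ncevE_nceval.
Qed.

(** * Layers of a regular circuit *)

Section CircuitStructure.
Variables (F : fieldType) (n : nat) (C : circuit F n).
Local Notation E := (@edge F n C).
Implicit Types (u v g : node C) (p : seq (node C)).

Lemma node_poly_add v r : label v = Add r ->
  node_poly v = \sum_(e <- r) e.1 *: node_poly e.2.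
Proof. by move=> lv; rewrite /node_poly cfoldE lv big_map. Qed.

Lemma node_poly_mul v u1 u2 : label v = Mul u1 u2 ->
  node_poly v = node_poly u1 * node_poly u2.
Proof. by move=> lv; rewrite /node_poly cfoldE lv. Qed.

Lemma sdeg_add v r : label v = Add r -> sdeg v = (\max_(e <- r) sdeg e.2)%N.
Proof. by move=> lv; rewrite /sdeg cfoldE lv big_map. Qed.

Lemma sdeg_mul v u1 u2 : label v = Mul u1 u2 -> sdeg v = (sdeg u1 + sdeg u2)%N.
Proof. by move=> lv; rewrite /sdeg cfoldE lv. Qed.

Lemma sdeg_leaf v : is_leaf (label v) -> (sdeg v <= 1)%N.
Proof. by rewrite /sdeg cfoldE; case: (label v). Qed.

Lemma node_ind (P : node C -> Prop) :
  (forall v, (forall u, E u v -> P u) -> P v) -> forall v, P v.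
Proof.
move=> step v; have [k] := ubnP #|[pred u | connect E u v]|.
elim: k v => // k IH v lt; apply: step => u uv; apply: IH.
rewrite -ltnS; apply: leq_trans lt; rewrite ltnS; apply: proper_card.
apply/properP; split.
  by apply/subsetP => w; rewrite !inE => wu; apply: connect_trans wu (connect1 uv).
by exists v; rewrite !inE ?connect0 //; apply: label_acyclic.
Qed.

Lemma exists_leaf_path v :
  exists u p, [/\ is_leaf (label u), path E u p & last u p = v].
Proof.
elim/node_ind: v => v IH.
have [lv|nl] := boolP (is_leaf (label v)); first by exists v, [::].
have [u uv] : exists u, E u v.
  move: nl; rewrite label_indeg /edge; case: (children (label v)) => // u l _.
  by exists u; rewrite inE eqxx.
have [w [p [lw pth lst]]] := IH u uv.
by exists w, (rcons p v); rewrite rcons_path pth lst last_rcons.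
Qed.

Lemma path_last_connect u p v : path E u p -> v \in u :: p -> connect E v (last u p).
Proof.
move=> pth /splitPl vp; case: vp pth => p1 p2 lst; rewrite cat_path => /andP[_ h].
by rewrite last_cat lst; apply/connectP; exists p2; rewrite // -lst.
Qed.

Lemma acyclic_path v p : path E v p -> v \notin p.
Proof.
case: p => // u p /= /andP[vu pth]; apply/negP => vp.
by have := label_acyclic vu; rewrite (path_connect pth vp).
Qed.

Variables (k : nat) (lay : node C -> 'I_k).
Hypothesis layP : add_layering lay.

(* Along a path p from v to the output (v excluded), the layers met are       *)
(* exactly those numbered a or more.                                          *)
Definition layers_above v p (a : nat) : Prop :=
  [/\ path E v p /\ last v p = output C, (a <= k)%N,
      forall g, g \in p -> is_add (label g) -> (a <= lay g)%N
    & forall i : 'I_k, (a <= i)%N ->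
        exists2 g, g \in p & is_add (label g) && (lay g == i)].

Lemma layers_above_output : layers_above (output C) [::] k.
Proof. by split=> // i; rewrite leqNgt ltn_ord. Qed.

Lemma layers_above_mul u v p a : ~~ is_add (label v) -> E u v ->
  layers_above v p a -> layers_above u (v :: p) a.
Proof.
move=> nv uv [[pth lst] ak lo hi]; split=> //=; first by rewrite uv pth.
  by move=> g; rewrite inE => /orP[/eqP -> av|/lo//]; rewrite av in nv.
by move=> i /hi[g gp hg]; exists g; rewrite // inE gp orbT.
Qed.

(** A path from a leaf to [v] meets no layer higher than that of [v], so each higher layer is met on
    [p]; the layer of [v] itself cannot recur there, as no path joins two of its gates. *)
Lemma layers_above_add v p a : is_add (label v) -> layers_above v p a ->
  a = (lay v).+1.
Proof.
case: layP => lay_neq lay_le _ lay_all av [[pth lst] ak lo hi].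
have lt : (lay v < a)%N.
  rewrite ltnNge; apply/negP => /hi[g gp /andP[ag /eqP e]].
  have ne : v != g by apply: contraNneq (acyclic_path pth) => ->.
  have cvg : connect E v g by apply: (path_connect pth); rewrite inE gp orbT.
  by have := lay_neq _ _ av ag ne cvg; rewrite e eqxx.
apply/eqP; rewrite eqn_leq lt andbT leqNgt; apply/negP => lt2.
have ltk : ((lay v).+1 < k)%N := leq_trans lt2 ak.
have [u [q [lu qpth qlst]]] := exists_leaf_path v.
have [||g] := lay_all u (q ++ p) lu _ _ (Ordinal ltk).
- by rewrite cat_path qpth qlst.
- by rewrite last_cat qlst.
rewrite -cat_cons mem_cat => /orP[gq|gp] /andP[ag /eqP e].
  have := lay_le _ _ ag av; rewrite -[v in connect _ _ v]qlst.
  by move=> /(_ (path_last_connect qpth gq)); rewrite e /= ltnn.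
by have := lo g gp ag; rewrite e /= leqNgt lt2.
Qed.

Lemma layers_above_child_add u v p : is_add (label v) -> E u v ->
  layers_above v p (lay v).+1 -> layers_above u (v :: p) (lay v).
Proof.
move=> av uv [[pth lst] ak lo hi]; split=> //=; first by rewrite uv pth.
- exact: ltnW.
- by move=> g; rewrite inE => /orP[/eqP -> //|gp ag]; apply: ltnW; apply: lo.
move=> i; rewrite leq_eqVlt => /orP[/eqP e|/hi[g gp hg]].
  by exists v; rewrite ?inE ?eqxx // av; apply/eqP/val_inj.
by exists g; rewrite // inE gp orbT.
Qed.

Lemma exists_layers_above v p : path E v p -> last v p = output C ->
  exists a, layers_above v p a.
Proof.
elim: p v => [|u p IH] v /= => [_ ->|/andP[vu pth] lst].
  by exists k; apply: layers_above_output.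
have [a h] := IH u pth lst.
have [au|nu] := boolP (is_add (label u)); last first.
  by exists a; apply: layers_above_mul.
have aE := layers_above_add au h.
by exists (lay u); apply: layers_above_child_add => //; rewrite -aE.
Qed.

Lemma layers_above_leaf v p a : (0 < k)%N -> is_leaf (label v) ->
  layers_above v p a -> a = 0%N.
Proof.
case: layP => _ _ _ lay_all k0 lv [[pth lst] ak lo hi].
have [g] := lay_all v p lv pth lst (Ordinal k0).
rewrite inE => /orP[/eqP -> /andP[av _]|gp /andP[ag /eqP e]].
  by move: lv av; case: (label v).
by apply/eqP; rewrite -leqn0; have := lo g gp ag; rewrite e.
Qed.

(** Descending through product gates keeps the threshold. The descent ends at sum gates, which then
    lie in layer [a], and never at a leaf, whose threshold is 0. *)
Lemma layers_above_prod v p a : layers_above v p a.+1 ->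
  exists l : seq (node C),
    [/\ node_poly v = \prod_(g <- l) node_poly g,
        sdeg v = (\sum_(g <- l) sdeg g)%N
      & forall g, g \in l -> [/\ is_add (label g), connect E g (output C)
                               & lay g = a :> nat]].
Proof.
elim/node_ind: v p => v IH p h.
have k0 : (0 < k)%N by case: h => _ ak _ _; apply: leq_trans ak.
case lv: (label v) => [i|c|r|u1 u2].
- by have := layers_above_leaf k0 _ h; rewrite lv => /(_ isT).
- by have := layers_above_leaf k0 _ h; rewrite lv => /(_ isT).
- have av : is_add (label v) by rewrite lv.
  exists [:: v]; rewrite !big_seq1; split=> // g; rewrite inE => /eqP ->.
  split=> //; last by have [] := layers_above_add av h.
  by case: h => -[pth <-] _ _ _; apply: path_last_connect; rewrite ?inE ?eqxx.
have e1 : E u1 v by rewrite /edge lv !inE eqxx.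
have e2 : E u2 v by rewrite /edge lv !inE eqxx orbT.
have nv : ~~ is_add (label v) by rewrite lv.
have [l1 [n1 s1 h1]] := IH _ e1 _ (layers_above_mul nv e1 h).
have [l2 [n2 s2 h2]] := IH _ e2 _ (layers_above_mul nv e2 h).
exists (l1 ++ l2); rewrite !big_cat /= -n1 -n2 -s1 -s2; split.
- exact: node_poly_mul.
- exact: sdeg_mul.
by move=> g; rewrite mem_cat => /orP[/h1|/h2].
Qed.

(** The threshold at a child of [g] is the layer of [g], here positive, which excludes leaves. *)
Lemma child_prod u g a : is_add (label g) -> connect E g (output C) ->
  lay g = a.+1 :> nat -> E u g ->
  ~~ is_leaf (label u) /\ exists l : seq (node C),
    [/\ node_poly u = \prod_(v <- l) node_poly v,
        sdeg u = (\sum_(v <- l) sdeg v)%N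
      & forall v, v \in l -> [/\ is_add (label v), connect E v (output C)
                               & lay v = a :> nat]].
Proof.
move=> ag /connectP[p pth lst] la ug.
have [b h] := exists_layers_above pth (esym lst).
have bE := layers_above_add ag h; rewrite bE in h.
have {}h := layers_above_child_add ag ug h; rewrite la in h.
split; last exact: layers_above_prod h.
apply/negP => lu; have k0 : (0 < k)%N by apply: leq_trans (ltn_ord (lay g)).
by have := layers_above_leaf k0 lu h.
Qed.

(** By homogeneity, the children of other syntactic degrees cancel out in total. Parallel edges are
    merged into one coefficient. *)
Lemma add_gate_combination g : homogeneous C -> is_add (label g) ->
  exists c : node C -> F,
    node_poly g = \sum_(u | E u g && (sdeg u == sdeg g)) c u *: node_poly u.
Proof.
move=> hC; case lg: (label g) => [//|//|r|//] _.
exists (fun u => \sum_(e <- r | e.2 == u) e.1).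
apply/malgP => w; have [wd|wd] := eqVneq (fdeg w) (sdeg g); last first.
  rewrite (coef_homog (hC g) wd) raddf_sum big1 //= => u /andP[_ /eqP e].
  by rewrite mcoeffZ (coef_homog (hC u)) ?mulr0 // e.
transitivity (\sum_(u | E u g) (\sum_(e <- r | e.2 == u) e.1) * (node_poly u)@_w).
  rewrite (node_poly_add lg) raddf_sum /=.
  rewrite big_seq (partition_big (fun e => e.2) (fun u => E u g)); last first.
    by move=> e er; rewrite /edge lg /= map_f.
  apply: eq_bigr => u _; rewrite mulr_suml [LHS]big_seq_cond [RHS]big_seq_cond.
  rewrite [LHS]big_mkcond [RHS]big_mkcond /=; apply: eq_bigr => e _.
  by case: (e \in r) => //=; case: eqP => // <-; rewrite mcoeffZ.
rewrite raddf_sum big_mkcondr /=; apply: eq_bigr => u _.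
case: eqP => [_|/eqP ne]; first by rewrite mcoeffZ.
by rewrite (coef_homog (hC u)) ?mulr0 // wd eq_sym.
Qed.

End CircuitStructure.

Lemma sum_prods_enum (R : idomainType) n (T T' : finType) (U : pred T)
    (c : T -> R) (h : T -> ncpol R n) (q : T' -> ncpol R n) (l : T -> seq T') :
  (forall u, U u -> h u = \prod_(g <- l u) q g) ->
  \sum_(u | U u) c u *: h u =
  sum_prods [seq (c u, [seq q g | g <- l u]) | u <- enum U].
Proof.
move=> hl; rewrite /sum_prods big_map big_enum; apply: eq_bigr => u /hl -> /=.
by rewrite big_map.
Qed.

(** * Three-layer circuits as nested sums of products *)

Section SigmaPiSigmaPiSigmaCircuits.
Variables (F : fieldType) (n : nat) (C : circuit F n) (lay : node C -> 'I_3).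
Hypothesis regC : add_regular lay.
Hypothesis bottom : forall v, is_add (label v) -> lay v = ord0 ->
  all (fun u => is_leaf (label u)) (children (label v)).
Local Notation E := (@edge F n C).
Local Notation L := (nclift (n := n) (@polyC F)).
Local Notation np := (@node_poly F n C).

Let homC : homogeneous C. Proof. by case: regC. Qed.
Let layP : add_layering lay. Proof. by case: regC. Qed.
Let inner := [pred u : node C | ~~ is_leaf (label u)].

Let sdeg_bottom v : is_add (label v) -> lay v = 0 :> nat -> (sdeg v <= 1)%N.
Proof.
move=> av lv; have l0 : lay v = ord0 by apply: val_inj.
have := bottom av l0.
case lab: (label v) av => [||r|] //= _ /allP leaves.
rewrite (sdeg_add lab); elim: r leaves {lab} => [|e r IH] leaves.
  by rewrite big_nil.
rewrite big_cons geq_max IH => [|u ur]; last by apply: leaves; rewrite inE ur orbT.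
by rewrite andbT sdeg_leaf // leaves // inE eqxx.
Qed.

Let sdeg_layer (u v : node C) :
  is_add (label u) -> is_add (label v) -> lay u = lay v :> nat -> sdeg u = sdeg v.
Proof. by case: layP => _ _ h _ au av e; apply: h => //; apply: val_inj. Qed.

Let homog_node v : homog (sdeg v) (L (np v)).
Proof. by apply: homog_lift; apply: homC. Qed.

(** Restricted to gates leading to the output, since the path condition of a layering speaks of
    paths ending there. *)
Let gates (a : nat) := [pred g : node C |
  [&& is_add (label g), connect E g (output C) & lay g == a :> nat]].

(** Only internal nodes are taken, so that the number of terms is bounded by the size of the
    circuit. *)
Let below (a d : nat) := [pred u : node C |
  [&& inner u, sdeg u == d & [exists g, gates a g && E u g]]].

Let card_below a d : (#|below a d| <= csize C)%N.
Proof. by apply: subset_leq_card; apply/subsetP => u /and3P[]. Qed.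

Let below_prod a d : exists l : node C -> seq (node C), forall u, below a.+1 d u ->
  [/\ np u = \prod_(v <- l u) np v,
      d = (\sum_(v <- l u) sdeg v)%N
    & forall v, v \in l u -> gates a v].
Proof.
apply: (fin_all_exists (P := fun u lu => below a.+1 d u ->
  [/\ np u = \prod_(v <- lu) np v, d = (\sum_(v <- lu) sdeg v)%N
    & forall v, v \in lu -> gates a v])) => u.
have [bu|nb] := boolP (below a.+1 d u); last by exists [::].
have /and3P[_ /eqP <- /existsP[g /andP[/and3P[ag cg /eqP lg] ug]]] := bu.
have [_ [l [e1 e2 e3]]] := child_prod layP ag cg lg ug.
by exists l => _; split=> // v /e3[av cv lv]; rewrite /gates /= av cv lv eqxx.
Qed.

Let gate_below a g : gates a.+1 g -> exists c : node C -> F,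
  np g = \sum_(u | below a.+1 (sdeg g) u) c u *: np u.
Proof.
move=> gg; have /and3P[ag cg /eqP lg] := gg.
have [c ->] := add_gate_combination homC ag.
exists (fun u => if E u g then c u else 0).
rewrite [RHS]big_mkcond [LHS]big_mkcond; apply: eq_bigr => u _.
case ug: (E u g) => /=; last by case: ifP => //; rewrite scale0r.
have [iu _] := child_prod layP ag cg lg ug.
rewrite iu /=; case: eqP => //= _.
by case: existsP => // -[]; exists g; rewrite ug andbT.
Qed.

Let lift_combination (U : pred (node C)) (c : node C -> F) :
  L (\sum_(u | U u) c u *: np u) = \sum_(u | U u) (c u)%:P *: L (np u).
Proof.
by rewrite (rmorph_sum L); apply: eq_bigr => u _; rewrite /= ncliftZ.
Qed.

(** The space V for the outer application: an F[X]-span that contains the lifted middle gates of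
    degree d. *)
Let middle d (f : ncpol {poly F} n) : Prop :=
  exists c : node C -> {poly F}, f = \sum_(u | below 1 d u) c u *: L (np u).

Let nonvanishing_middle d f : (0 < d)%N -> middle d f -> f != 0 ->
  nonvanishing (2 * csize C) f.
Proof.
move=> d0 [c fE]; have [l hl] := below_prod 0 d.
have fs : f = sum_prods [seq (c u, [seq L (np g) | g <- l u]) | u <- enum (below 1 d)].
  rewrite fE; apply: sum_prods_enum => u /hl[-> _ _].
  by rewrite (rmorph_prod L).
rewrite fs => nz.
apply: (@nonvanishing_leq _ _ (2 * size
  [seq (c u, [seq L (np g) | g <- l u]) | u <- enum (below 1 d)] * 1)).
  by rewrite muln1 leq_mul2l size_map -cardE card_below.
apply: (@nonvanishing_sum_prods _ n 0 1 (@has_nonroots_poly F) (homog 1)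
  _ _ _ _ _ _ d) => //.
- exact: homog0.
- by move=> f1 f2; apply: homogD.
- by move=> a f1; apply: homogZ.
- by move=> f1; apply: nonvanishing_linear_form.
move=> x /mapP[u]; rewrite mem_enum => /hl[_ dE lg] -> /=.
(* Bottom gates have degree at most 1 and share one degree; were it 0, the product could not have
   positive degree [d]. *)
have sdeg1 g : g \in l u -> sdeg g = 1%N.
  move=> gl; have /and3P[ag _ /eqP g0] := lg g gl.
  apply/eqP; rewrite eqn_leq sdeg_bottom // lt0n; apply: contraTneq d0 => z.
  rewrite dE -leqNgt leqn0 sum_nat_seq_eq0; apply/allP => v vl; apply/implyP => _.
  have /and3P[av _ /eqP v0] := lg v vl.
  by rewrite (sdeg_layer av ag) ?z // v0 g0.
split.
  by rewrite size_map [RHS]dE (eq_big_seq (fun=> 1%N) sdeg1) sum1_size.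
by move=> q /mapP[g gl ->]; rewrite -(sdeg1 g gl); apply: homog_node.
Qed.

Lemma nonvanishing_circuit : (0 < sdeg (output C))%N -> circuit_poly C != 0 ->
  nonvanishing (csize C ^ 6) (L (circuit_poly C)).
Proof.
set D := sdeg _; move=> D0 nz.
have ao : is_add (label (output C)) by case: regC.
have lo : lay (output C) = 2 :> nat.
  by have [] := layers_above_add layP ao (layers_above_output lay).
have go : gates 2 (output C) by rewrite /gates /= ao connect0 lo eqxx.
have [c fE] := gate_below go; have [l hl] := below_prod 1 D.
have [u0 u0b] : exists u, below 2 D u.
  apply/existsP; apply: contraNT nz; rewrite negb_exists => /forallP h.
  by rewrite /circuit_poly fE big1 // => u; rewrite (negbTE (h u)).
have [g0 [g0l g0s]] : exists g0, g0 \in l u0 /\ (0 < sdeg g0)%N.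
  have [_ dE _] := hl _ u0b; move: D0; rewrite dE lt0n sum_nat_seq_neq0.
  by case/hasP => g gl; rewrite -lt0n; exists g.
pose d := sdeg g0.
have sdegl u g : below 2 D u -> g \in l u -> gates 1 g /\ sdeg g = d.
  move=> ub gl; have [_ _ h] := hl _ ub; split; first exact: h.
  have [_ _ h0] := hl _ u0b.
  have /and3P[ag _ /eqP lg] := h _ gl; have /and3P[ag0 _ /eqP lg0] := h0 _ g0l.
  by apply: sdeg_layer; rewrite ?lg.
(* A middle gate and the output are two distinct gates; 4s^2 <= s^6 would fail for s = 1. *)
have s2 : (1 < csize C)%N.
  have [/and3P[ag0 _ /eqP lg0] _] := sdegl _ _ u0b g0l.
  have ne : g0 != output C by apply: contra_eqN lo => /eqP <-; rewrite lg0.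
  have c2 : #|[set g0; output C]| = 2 by rewrite cards2 ne.
  rewrite -[X in (X <= _)%N]c2; apply: subset_leq_card.
  apply/subsetP => g; rewrite !inE => /orP[] /eqP ->.
    by case: (label g0) ag0.
  by case: (label (output C)) ao.
have m_gt0 : (0 < 2 * csize C)%N by rewrite muln_gt0 (ltnW s2).
have fs : L (circuit_poly C) = sum_prods
    [seq ((c u)%:P, [seq L (np g) | g <- l u]) | u <- enum (below 2 D)].
  rewrite /circuit_poly fE lift_combination; apply: sum_prods_enum => u /hl[-> _ _].
  by rewrite (rmorph_prod L).
have nzL : L (circuit_poly C) != 0.
  apply: contraNneq nz => e; apply/eqP/malgP => w; rewrite mcoeff0.
  by apply: polyC_inj; rewrite -(coef_nclift polyC) e mcoeff0.
rewrite fs in nzL *.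
apply: (@nonvanishing_leq _ _ (2 * size
  [seq ((c u)%:P, [seq L (np g) | g <- l u]) | u <- enum (below 2 D)]
  * (2 * csize C).-1.+1)).
  rewrite prednK // size_map -cardE.
  apply: (@leq_trans (2 * csize C * (2 * csize C))).
    by rewrite leq_mul2r leq_mul2l card_below !orbT.
  rewrite mulnACA (expnD _ 4 2) -mulnn leq_mul2r.
  by apply/orP; right; apply: (@leq_trans (2 ^ 4)); rewrite // leq_exp2r.
(* All factors have degree [d] and their degrees add up to [D], so each product has [D %/ d]
   factors. *)
apply: (@nonvanishing_sum_prods _ n (2 * csize C).-1 d (@has_nonroots_poly F)
  (middle d) _ _ _ _ _ _ (D %/ d)) => //.
- by exists (fun=> 0); rewrite big1 // => u _; rewrite scale0r.
- move=> f1 f2 [c1 ->] [c2 ->]; exists (fun u => c1 u + c2 u).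
  by rewrite -big_split; apply: eq_bigr => u _; rewrite scalerDl.
- move=> a f1 [c1 ->]; exists (fun u => a * c1 u).
  by rewrite scaler_sumr; apply: eq_bigr => u _; rewrite scalerA.
- move=> f1 [c1 ->]; apply: homog_sum => u /and3P[_ /eqP <- _].
  by apply: homogZ; apply: homog_node.
- by move=> f1 hf1 nz1; rewrite prednK //; apply: nonvanishing_middle hf1 nz1.
move=> x /mapP[u]; rewrite mem_enum => ub -> /=; split.
  have [_ dE _] := hl _ ub; rewrite size_map dE big_seq.
  rewrite (eq_bigr (fun=> d)) => [|g gl]; last by have [] := sdegl _ _ ub gl.
  by rewrite -big_seq big_const_seq count_predT iter_addn_0 mulKn.
move=> q /mapP[g gl ->]; have [gg sg] := sdegl _ _ ub gl.
have [cg gE] := gate_below gg; exists (fun u => (cg u)%:P).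
by rewrite gE lift_combination sg.
Qed.

End SigmaPiSigmaPiSigmaCircuits.

(** * Degree of the output and conclusion *)

Lemma ncdeg_homog (F : fieldType) n d (f : ncpoly F n) :
  nchomog d f -> f != 0 -> ncdeg f = d.
Proof.
move=> hf nz; rewrite /ncdeg /mmeasure big_seq.
rewrite (eq_bigr (fun=> d.+1)) => [|w /hf <- //].
rewrite -big_seq big_const_seq count_predT.
have it k : iter k.+1 (maxn d.+1) 0%N = d.+1.
  by elim: k => [|k IH]; [rewrite /= maxn0 | rewrite iterS IH maxnn].
have [w wf] : exists w, w \in msupp f by apply/fset0Pn; rewrite msupp_eq0.
have {wf}: w \in enum_fset (msupp f) := wf.
by case: (enum_fset _) => // w0 r _; rewrite it.
Qed.

Theorem mainTheorem2 :
  forall D : nat, exists b : nat,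
  forall (F : fieldType) (n s : nat) (f : ncpoly F n) (C : circuit F n),
    card_ge F b ->
    SigmaPiSigmaPiSigma C ->
    csize C = s ->
    circuit_poly C = f ->
    ncdeg f = D ->
    (f != 0 <-> exists A : 'I_n -> 'M[F]_(s ^ 6)%N, nceval A f != 0).
Proof.
(* [D.+1] scalars are what the specialisation from F[X] to F asks for. *)
move=> D; exists D.+1 => F n s f C [r ur sr] [lay [regC bottom]] sE fE degf.
split=> [nz|[A]]; last first.
  by apply: contraNneq => ->; rewrite -ncevE_nceval raddf0.
have [homC ao _] := regC.
have hf0 : nchomog (sdeg (output C)) f by rewrite -fE; apply: homC.
have DE : D = sdeg (output C) by rewrite -degf (ncdeg_homog hf0 nz).
have hf : nchomog D f by rewrite DE.
have s0 : (0 < s ^ 6)%N.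
  rewrite expn_gt0 -sE; apply/orP; left; apply/card_gt0P; exists (output C).
  by rewrite inE; case: (label (output C)) ao.
(* In degree 0 the value is a nonzero scalar matrix, of positive size because the output is counted
   as a gate. *)
have [D0|D0] := posnP D.
  exists (fun=> 0); have fC : f = (f@_mone)%:MP.
    apply/malgP => w; rewrite mcoeffC.
    have [->|w1] := eqVneq w mone; first by rewrite mulr1n.
    by rewrite (coef_homog hf) // D0 fdeg_eq0.
  rewrite fC -ncevE_nceval ncevC /=; apply: contraNneq nz => /matrixP.
  move=> /(_ (Ordinal s0) (Ordinal s0)); rewrite !mxE eqxx mulr1n => c0.
  by rewrite fC c0 malgC0E.
apply: (nceval_lift_neq0 ur sr hf); rewrite -fE -sE.
by apply: (nonvanishing_circuit regC bottom); rewrite -?DE // fE.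
Qed.
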